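(* Let $n\ge 6$ be an integer and let $p,q\ge 3$ be two integers satisfying $n=p+q$. For any spatial embedding $f$ of the complete graph $K_n$, we have $$\sum_{\lambda\in\Gamma_{p,q}(K_n)}\mathrm{lk}(f(\lambda))^2\ \ge\ \begin{cases}\dfrac{n!}{6!} & (p=q),\\[2mm] 2\cdot\dfrac{n!}{6!} & (p\neq q).\end{cases}$$ In particular, $$\sum_{p+q=n}\ \sum_{\lambda\in\Gamma_{p,q}(K_n)}\mathrm{lk}(f(\lambda))^2\ \ge\ (n-5)\cdot\frac{n!}{6!},$$ where the outer sum runs over all unordered pairs $\{p,q\}$ of integers $p,q\ge 3$ with $p+q=n$.
   Context: We work in the piecewise linear category. $K_n$ is the complete graph on the $n$ vertices $1,\dots,n$. A spatial embedding of a finite graph $G$ is a (piecewise linear) embedding $f$ of $G$ into $\mathbb{R}^3$. A cycle of $G$ is a subgraph homeomorphic to a circle; a $p$-cycle is a cycle with exactly $p$ edges. $\Gamma_{p,q}(G)$ denotes the set of all unordered pairs $\lambda=\gamma\cup\gamma'$ of two (vertex-)disjoint cycles of $G$ consisting of a $p$-cycle and a $q$-cycle. For such $\lambda$, $f(\lambda)$ is a 2-component link and $\mathrm{lk}(f(\lambda))$ is its linking number; it is defined up to sign unless the components are oriented, so $\mathrm{lk}(f(\lambda))^2$ is well defined. *)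

(* Defs.v *)
From HB Require Import structures.
From mathcomp Require Import all_boot all_order all_algebra.

Set Implicit Arguments.
Unset Strict Implicit.
Unset Printing Implicit Defensive.
Import Order.TTheory GRing.Theory Num.Theory.
Local Open Scope ring_scope.

(* Subgraphs without isolated vertices are identified with their edge sets; an
   edge is a 2-element set of vertices. *)
Definition cycle_edges (n : nat) (c : seq 'I_n) : {set {set 'I_n}} :=
  [set [set x; next c x] | x in c].

Definition cycles (n p : nat) : {set {set {set 'I_n}}} :=
  [set E | (3 <= p)%N &&
           [exists c : p.-tuple 'I_n, uniq c && (cycle_edges c == E)]].

(* Gamma_{p,q}(K_n); an element is the unordered pair of its two cycles. *)
Definition cycle_pairs (n p q : nat) : {set {set {set {set 'I_n}}}} :=
  [set [set E1; E2] | E1 in cycles n p,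
                      E2 in cycles n q & [disjoint cover E1 & cover E2]].

(* An arbitrary orientation of the cycle with edge set E, which has #|E|
   vertices. *)
Definition orient (n : nat) (E : {set {set 'I_n}}) : seq 'I_n :=
  if [pick c : #|E|.-tuple 'I_n | uniq c && (cycle_edges c == E)] is Some c
  then tval c else [::].

From mathcomp Require Import boolp classical_sets functions reals numfun.

(* The underlying space |K_n| of the complete graph is the 1-skeleton of the
   standard simplex in R^n: vertex i is the i-th basis vector, and
   [edge_point i j t] runs linearly along the edge from vertex i (t = 0) to
   vertex j (t = 1). *)
Definition edge_point (R : realType) (n : nat) (i j : 'I_n) (t : R) : 'rV[R]_n :=
  (1 - t) *: delta_mx 0 i + t *: delta_mx 0 j.

Definition complete_graph_space (R : realType) (n : nat) : set 'rV[R]_n :=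
  [set x | exists i j t, [/\ i != j, 0 <= t <= 1 & x = edge_point i j t]]%classic.

(* A piecewise linear embedding |K_n| -> R^3, packaged with a witness of
   piecewise linearity: for i < j, [emb_subdiv i j] = [:: t_1; ...; t_m] is a
   subdivision 0 = t_0 < t_1 < ... < t_m = 1 of the edge ij such that the map is
   affine on each subinterval.  Values of [emb_map] off |K_n|, and of
   [emb_subdiv i j] for j <= i, are irrelevant. *)
Record spatial_embedding (R : realType) (n : nat) := SpatialEmbedding {
  emb_map :> 'rV[R]_n -> 'rV[R]_3;
  emb_subdiv : 'I_n -> 'I_n -> seq R;
  emb_partition : forall i j : 'I_n, (i < j)%N ->
    itv_partition 0 1 (emb_subdiv i j);
  emb_affine : forall (i j : 'I_n) (k : nat) (u : R),
    (i < j)%N -> (k < size (emb_subdiv i j))%N -> 0 <= u <= 1 ->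
    let a := nth 0 (0 :: emb_subdiv i j) k in
    let b := nth 0 (emb_subdiv i j) k in
    emb_map (edge_point i j ((1 - u) * a + u * b)) =
    (1 - u) *: emb_map (edge_point i j a) + u *: emb_map (edge_point i j b);
  emb_inj : set_inj (@complete_graph_space R n) emb_map
}.

(* Vertices of the polygonal arc f(ij), travelled from f(i) included to f(j)
   excluded. *)
Definition edge_arc (R : realType) (n : nat) (f : spatial_embedding R n)
    (i j : 'I_n) : seq 'rV[R]_3 :=
  if (i < j)%N then
    [seq f (edge_point i j t) | t <- belast 0 (emb_subdiv f i j)]
  else
    [seq f (edge_point j i t) | t <- rev (emb_subdiv f j i)].

(* The closed polygon f(c), for an oriented cycle c of K_n given by its cyclic
   sequence of vertices. *)
Definition cycle_polygon (R : realType) (n : nat) (f : spatial_embedding R n)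
    (c : seq 'I_n) : seq 'rV[R]_3 :=
  flatten [seq edge_arc f x (next c x) | x <- c].

(* A closed polygon is the cyclic sequence of its vertices. *)
Definition polygon_edges (R : realType) (P : seq 'rV[R]_3) :
    seq ('rV[R]_3 * 'rV[R]_3) :=
  zip P (rot 1 P).

Definition segment_point (R : realType) (s : 'rV[R]_3 * 'rV[R]_3) (t : R) :
    'rV[R]_3 :=
  (1 - t) *: s.1 + t *: s.2.

Definition shadows_meet (R : realType) (v : 'rV[R]_3)
    (s s' : 'rV[R]_3 * 'rV[R]_3) : Prop :=
  exists t t' h : R, [/\ 0 <= t <= 1, 0 <= t' <= 1 &
    segment_point s' t' - segment_point s t = h *: v].

(* v is a regular direction of projection for the link P, Q: no vertex of one
   polygon is projected along v onto the other polygon.  Hence the projections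
   of P and Q meet only transversally, in interior points of edges.
   (Self-crossings of P or of Q do not enter the linking number.) *)
Definition regular_direction (R : realType) (P Q : seq 'rV[R]_3)
    (v : 'rV[R]_3) : Prop :=
  v != 0 /\
  forall s s', s \in polygon_edges P -> s' \in polygon_edges Q ->
    ~ shadows_meet v (s.1, s.1) s' /\ ~ shadows_meet v s (s'.1, s'.1).

Definition det3 (R : realType) (a b c : 'rV[R]_3) : R :=
  \det (\matrix_(i < 3) nth 0 [:: a; b; c] i).

(* If x on s and y on s' satisfy x - y = h *: v, then
   det3 (s.2 - s.1) (s'.2 - s'.1) (s.1 - s'.1)
     = h * det3 (s.2 - s.1) (s'.2 - s'.1) v,
   so that this is the usual right-handed sign of the crossing of s and s' in
   the projection along v (s being the upper strand when h > 0). *)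
Definition crossing_sign (R : realType) (s s' : 'rV[R]_3 * 'rV[R]_3) : int :=
  sgz (det3 (s.2 - s.1) (s'.2 - s'.1) (s.1 - s'.1)).

(* Half the sum of the signs of the crossings between P and Q in a regular
   projection. *)
Definition linking_number (R : realType) (P Q : seq 'rV[R]_3) : rat :=
  let v := xget 0 [set v | regular_direction P Q v]%classic in
  (\sum_(s <- polygon_edges P)
     \sum_(s' <- polygon_edges Q | `[< shadows_meet v s s' >])
       crossing_sign s s')%:~R / 2.

(* lk(f(L)) for L in Gamma_{p,q}(K_n), the two components being ordered and
   oriented arbitrarily; only its square is meaningful. *)
Definition lk (R : realType) (n : nat) (f : spatial_embedding R n)
    (L : {set {set {set 'I_n}}}) : rat :=
  linking_number (cycle_polygon f (orient (nth finset.set0 (enum L) 0)))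
                 (cycle_polygon f (orient (nth finset.set0 (enum L) 1))).

(* Main.v *)
Require Import Defs.
From mathcomp Require Import boolp classical_sets functions reals numfun.
From mathcomp Require Import all_boot all_order all_fingroup all_algebra.
From mathcomp Require Import ring lra zify.

(** Why the inequality holds.

    Fix a direction of projection v.  By definition the linking number of two
    disjoint polygons is half the sum of the signs of their crossings, so it
    is bilinear: lk (f (c), f (c')) is a sum, over the edges xy of c and zw of
    c', of numbers O x y z w that change sign when an edge is reversed.  Two
    facts then give the theorem.

    Averaging.  Let pi run through all permutations of the n = p + q vertices
    and expand the square of lk (pi c, pi c').  With c' fixed, products that
    come from two disjoint edges of c cancel, because exchanging the ends of
    one of them changes a sign; the squares of single edges and the products
    of adjacent edges all have averages that do not depend on c.  So the
    average over pi is proportional to the length of c (sum_sqr_cycle), and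
    likewise for c'.  Hence it is pq/9 times the same average for a pair of
    disjoint triangles (perm_sum_triangle).

    Parity.  For any six vertices the linking numbers of the ten pairs of
    complementary triangles have an odd, hence nonzero, sum (sum_triangles_neq0,
    after Conway-Gordon and Sachs), so their squares add up to at least 1, and
    the average for a pair of triangles is at least 1/10.

    Together, the average of lk (pi c, pi c') ^ 2 is at least pq/90
    (perm_sum_ge).  A pair of disjoint cycles of lengths p and q arises from at
    most 4pq permutations, 8pq if p = q (card_block_cycle_pairs), and dividing
    gives the bounds n!/360 and n!/720.

    Both facts need the geometry of projections.  Consider two segments s and
    s'.  The differences of their points fill a parallelogram, and the shadows
    of s and s' along v meet iff the line spanned by v meets it.  Let u be a
    second direction.  The plane of v and u cuts the parallelogram in a segment
    whose ends lie on its boundary, and each quantity below can be read off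
    from those two ends, that is, it is a sum of terms indexed by the boundary
    edges of the parallelogram:
    - the intersection number of the two shadows (planar_crossing_patch);
    - the difference of the crossing signs along v and along u
      (signed_crossing_patch).
    In a sum over two polygonal paths the boundary terms cancel between
    adjacent parallelograms and only the ends of the paths remain
    (patch_sum_arcs).  For closed polygons nothing remains: the linking number
    does not depend on the direction of projection (sum_signed_crossing_indep),
    so one generic v serves for all cycles, and the intersection number of two
    closed shadows is zero, so that it suffices to count the crossings at which
    the second polygon is the upper one; these are integers.  For the images of
    two disjoint edges xy and zw the remaining terms express the planar
    intersection number by summands that depend on one edge and one vertex only,
    and by the order of x, y, z, w with respect to a linear form
    (planar_crossing_decomposition).  Modulo 2 the sum of the ten linking numbers is
    the number of crossings between disjoint edges of the complete graph on
    five of the six vertices.  There each such summand occurs twice, and what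
    the order contributes is odd. *)

Set Implicit Arguments.
Unset Strict Implicit.
Unset Printing Implicit Defensive.
Import Order.TTheory GRing.Theory Num.Theory.
Local Open Scope ring_scope.

(** * Signs at the corners of a parallelogram *)

Definition same_sign (R : realDomainType) (m0 m1 m2 m3 : R) : bool :=
  [&& 0 < m0, 0 < m1, 0 < m2 & 0 < m3] || [&& m0 < 0, m1 < 0, m2 < 0 & m3 < 0].

(** Data read off a parallelogram with corners y0, y1, y2, y3 in cyclic order:
    ci is the value at yi of a linear form that vanishes at a vector v, and mi is
    the determinant of yi, y(i+1) and v.  Modulo v the corners lie in a plane; the
    last equation is the linear relation between three vectors of that plane. *)
Definition square_data (R : realFieldType) (c0 c1 c2 c3 m0 m1 m2 m3 : R) : Prop :=
  [/\ c0 + c2 = c1 + c3, m0 + m2 = m1 + m3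
    & c0 * (m2 - m3) + c1 * m3 + c3 * m0 = 0].

(** Holds if an edge of the parallelogram, whose ends lie on different sides of
    the plane c = 0, crosses this plane away from the line spanned by v. *)
Definition transverse (R : realFieldType) (c c' m : R) : Prop :=
  sgz c != sgz c' -> m != 0.

Definition side_term (R : realFieldType) (c c' : R) (e : int) : int :=
  if sgz c == sgz c' then 0 else e.

Lemma same_sign_rot (R : realDomainType) (m0 m1 m2 m3 : R) :
  same_sign m1 m2 m3 m0 = same_sign m0 m1 m2 m3.
Proof.
by rewrite /same_sign; do ![case: (_ < _)].
Qed.

Lemma square_rot (R : realFieldType) (c0 c1 c2 c3 m0 m1 m2 m3 : R) :
  square_data c0 c1 c2 c3 m0 m1 m2 m3 -> square_data c1 c2 c3 c0 m1 m2 m3 m0.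
Proof. by case=> h1 h2 h3; split; nra. Qed.

Lemma square_opp (R : realFieldType) (c0 c1 c2 c3 m0 m1 m2 m3 : R) :
  square_data c0 c1 c2 c3 m0 m1 m2 m3 ->
  square_data (- c0) (- c1) (- c2) (- c3) m0 m1 m2 m3.
Proof. by case=> h1 h2 h3; split; nra. Qed.

(** An affine function on a square that vanishes at no corner has constant sign,
    or isolates one corner, or separates two opposite edges; up to rotating the
    corners and changing the sign this leaves three patterns. *)
Lemma square_ind (R : realFieldType) (P : R -> R -> R -> R -> Prop) :
  (forall a b c d : R, P b c d a -> P a b c d) ->
  (forall a b c d : R, P (- a) (- b) (- c) (- d) -> P a b c d) ->
  (forall a b c d : R, 0 < a -> 0 < b -> 0 < c -> 0 < d -> P a b c d) ->
  (forall a b c d : R, a < 0 -> 0 < b -> 0 < c -> 0 < d -> P a b c d) ->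
  (forall a b c d : R, a < 0 -> 0 < b -> 0 < c -> d < 0 -> P a b c d) ->
  forall a b c d : R, a != 0 -> b != 0 -> c != 0 -> d != 0 ->
    a + c = b + d -> P a b c d.
Proof.
move=> Prot Popp P0 P1 P2 a b c d.
pose base (a b c d : R) := [|| [&& 0 < a, 0 < b, 0 < c & 0 < d],
  [&& a < 0, 0 < b, 0 < c & 0 < d] | [&& a < 0, 0 < b, 0 < c & d < 0]].
have Pbase (a' b' c' d' : R) : base a' b' c' d' -> P a' b' c' d'.
  by case/or3P=> /and4P[]; [apply: P0|apply: P1|apply: P2].
have Prots (a' b' c' d' : R) : [|| base a' b' c' d', base b' c' d' a',
    base c' d' a' b' | base d' a' b' c'] -> P a' b' c' d'.
  case/or4P=> /Pbase //; first exact: (Prot).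
    by move=> h; do 2!apply: (Prot).
  by move=> h; do 3!apply: (Prot).
case: (ltgtP a 0) => // a0 _; case: (ltgtP b 0) => // b0 _;
  case: (ltgtP c 0) => // c0 _; case: (ltgtP d 0) => // d0 _ e;
  try (exfalso; lra); try (by apply: Prots; rewrite /base ?a0 ?b0 ?c0 ?d0 ?orbT);
  apply: Popp; apply: Prots;
  by rewrite /base ?oppr_gt0 ?oppr_lt0 ?a0 ?b0 ?c0 ?d0 ?orbT.
Qed.

Lemma same_sign_sgz (R : realDomainType) (m0 m1 m2 m3 : R) :
  same_sign m0 m1 m2 m3 -> sgz (m0 + m2) = sgz m0.
Proof.
by case/orP=> /and4P[h0 _ h2 _];
  [rewrite !gtr0_sgz ?addr_gt0 | rewrite !ltr0_sgz // -oppr_gt0 opprD addr_gt0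
    ?oppr_gt0].
Qed.

(** The plane c = 0 cuts the parallelogram in a segment between the two edges at
    the isolated corner.  The line spanned by v lies in this plane, and it meets
    the parallelogram iff it separates the ends of this segment. *)
Lemma same_sign_corner (R : realFieldType) (c0 c1 c2 c3 m0 m1 m2 m3 : R) :
  square_data c0 c1 c2 c3 m0 m1 m2 m3 ->
  c0 < 0 -> 0 < c1 -> 0 < c2 -> 0 < c3 -> m0 != 0 -> m3 != 0 ->
  same_sign m0 m1 m2 m3 = (sgz m0 == sgz m3).
Proof.
rewrite /same_sign => -[e f g] c0N c1P c2P c3P.
case: (sgzP m0) => // hm0 _; case: (sgzP m3) => // hm3 _; rewrite ?andbF //=.
- have -> : 0 < m1 by nra.
  by have -> : 0 < m2 by nra.
- have -> : m1 < 0 by nra.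
  by have -> : m2 < 0 by nra.
Qed.

(** As before, with a segment that joins two opposite edges. *)
Lemma same_sign_side (R : realFieldType) (c0 c1 c2 c3 m0 m1 m2 m3 : R) :
  square_data c0 c1 c2 c3 m0 m1 m2 m3 ->
  c0 < 0 -> 0 < c1 -> 0 < c2 -> c3 < 0 -> m0 != 0 -> m2 != 0 ->
  same_sign m0 m1 m2 m3 = (sgz m0 == sgz m2).
Proof.
rewrite /same_sign => -[e f g] c0N c1P c2P c3P.
case: (sgzP m0) => // hm0 _; case: (sgzP m2) => // hm2 _; rewrite ?andbF //=.
- have -> : 0 < m1 by nra.
  by have -> : 0 < m3 by nra.
- have -> : m1 < 0 by nra.
  by have -> : m3 < 0 by nra.
Qed.

Lemma square_allpos (R : realFieldType) (c0 c1 c2 c3 m0 m1 m2 m3 : R) :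
  square_data c0 c1 c2 c3 m0 m1 m2 m3 ->
  0 < c0 -> 0 < c1 -> 0 < c2 -> 0 < c3 -> same_sign m0 m1 m2 m3 = false.
Proof.
case=> e f g c0P c1P c2P c3P.
have h : c0 * (m1 * m2) + c1 * (m3 * m2) + c2 * (m3 * m0) + c3 * (m1 * m0) = 0.
  have -> : c2 = c1 + c3 - c0 by lra.
  have -> : m1 = m0 + m2 - m3 by lra.
  by transitivity ((m0 + m2) * (c0 * (m2 - m3) + c1 * m3 + c3 * m0));
    [ring | rewrite g mulr0].
apply/negbTE/negP => /orP[] /and4P[m0P m1P m2P m3P].
all: suff: 0 < c0 * (m1 * m2) + c1 * (m3 * m2) + c2 * (m3 * m0) + c3 * (m1 * m0);
  first by rewrite h ltxx.
- by rewrite !addr_gt0 // !mulr_gt0.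
- by rewrite !addr_gt0 //; rewrite pmulr_rgt0 // nmulr_rgt0.
Qed.

(** If all mi have the same sign, the line meets the parallelogram, and the sign is
    the winding number of the boundary about the line.  A winding number can be
    found by counting how the boundary crosses the two halves of a line through the
    centre, here the trace of the plane c = 0. *)
Lemma square_planar (R : realFieldType) (c0 c1 c2 c3 m0 m1 m2 m3 : R) :
  c0 != 0 -> c1 != 0 -> c2 != 0 -> c3 != 0 ->
  square_data c0 c1 c2 c3 m0 m1 m2 m3 ->
  transverse c0 c1 m0 -> transverse c1 c2 m1 ->
  transverse c2 c3 m2 -> transverse c3 c0 m3 ->
  (if same_sign m0 m1 m2 m3 then sgz (m0 + m2) else 0) *+ 2 =
  side_term c0 c1 (sgz m0) + side_term c1 c2 (sgz m1)
  + side_term c2 c3 (sgz m2) + side_term c3 c0 (sgz m3).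
Proof.
move=> z0 z1 z2 z3 sq; have e : c0 + c2 = c1 + c3 by case: sq.
move: m0 m1 m2 m3 sq; rewrite /transverse /side_term.
pattern c0, c1, c2, c3; apply: square_ind z0 z1 z2 z3 e => {c0 c1 c2 c3}.
- move=> a b c d IH m0 m1 m2 m3 /square_rot sq t0 t1 t2 t3.
  have := IH m1 m2 m3 m0 sq t1 t2 t3 t0; rewrite same_sign_rot.
  have -> : m1 + m3 = m0 + m2 by case: sq => _ -> _; rewrite addrC.
  by move=> ->; rewrite addrC !addrA.
- move=> a b c d IH m0 m1 m2 m3 /square_opp sq t0 t1 t2 t3.
  have := IH m0 m1 m2 m3 sq; rewrite !sgzN !eqr_opp; exact.
- move=> a b c d a0 b0 c0 d0 m0 m1 m2 m3 sq _ _ _ _.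
  by rewrite (square_allpos sq) // (gtr0_sgz a0) (gtr0_sgz b0) (gtr0_sgz c0)
    (gtr0_sgz d0).
- move=> a b c d a0 b0 c0 d0 m0 m1 m2 m3 sq.
  rewrite (ltr0_sgz a0) (gtr0_sgz b0) (gtr0_sgz c0) (gtr0_sgz d0) /= =>
    /(_ isT) n0 _ _ /(_ isT) n3.
  have := @same_sign_sgz _ m0 m1 m2 m3; rewrite (same_sign_corner sq) // => E.
  by case: ifP => [h|/negbT]; [rewrite (E h); move: h|]; move: n0 n3;
    case: (sgzP m0) => // ? _; case: (sgzP m3).
- move=> a b c d a0 b0 c0 d0 m0 m1 m2 m3 sq.
  rewrite (ltr0_sgz a0) (gtr0_sgz b0) (gtr0_sgz c0) (ltr0_sgz d0) /= =>
    /(_ isT) n0 _ /(_ isT) n3 _.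
  have := @same_sign_sgz _ m0 m1 m2 m3; rewrite (same_sign_side sq) // => E.
  by case: ifP => [h|/negbT]; [rewrite (E h); move: h|]; move: n0 n3;
    case: (sgzP m0) => // ? _; case: (sgzP m2).
Qed.

Lemma sgzB_opp (R : realDomainType) (x y : R) :
  sgz x = - sgz y -> sgz (x - y) = sgz x.
Proof.
case: (sgzP x) => [->|hx|hx]; case: (sgzP y) => [->|hy|hy] // _.
- by rewrite subrr sgz0.
- by rewrite gtr0_sgz // subr_gt0 (lt_trans hy).
- by rewrite ltr0_sgz // subr_lt0 (lt_trans hx).
Qed.

Lemma sgz_minor (R : realDomainType) (m m' n n' : R) :
  m != 0 -> m' != 0 -> n != 0 -> n' != 0 ->
  sgz (m' * n - m * n') *+ 2 * ((sgz m == sgz m')%:R - (sgz n == sgz n')%:R) =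
  (sgz m * sgz n - sgz m' * sgz n') :> int.
Proof.
move=> z z' w w'; have := @sgzB_opp _ (m' * n) (m * n'); rewrite !sgzM;
  move: z z' w w'.
case: (sgzP m) => // hm _; case: (sgzP m') => // hm' _;
  case: (sgzP n) => // hn _; case: (sgzP n') => // hn' _ //=;
  first [by rewrite mulr0 | by move=> /(_ erefl) ->].
Qed.

(** Let the mi and ni belong to two vectors v and u that span the plane c = 0.
    Their lines divide this plane into four quadrants, and the sign of mi * ni tells
    in which pair of opposite quadrants the boundary edge i crosses it.  Exactly one
    of the two lines separates the ends of the segment cut out by the plane iff these
    pairs differ, and which one it is depends on the sense in which the segment turns
    about the origin, that is, on the sign of d. *)
Lemma square_rotation (R : realFieldType)
  (c0 c1 c2 c3 m0 m1 m2 m3 n0 n1 n2 n3 d : R) :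
  c0 != 0 -> c1 != 0 -> c2 != 0 -> c3 != 0 ->
  square_data c0 c1 c2 c3 m0 m1 m2 m3 ->
  square_data c0 c1 c2 c3 n0 n1 n2 n3 ->
  m0 * n3 - m3 * n0 = c0 * d -> m1 * n0 - m0 * n1 = c1 * d ->
  m2 * n1 - m1 * n2 = c2 * d -> m3 * n2 - m2 * n3 = c3 * d ->
  transverse c0 c1 m0 -> transverse c1 c2 m1 ->
  transverse c2 c3 m2 -> transverse c3 c0 m3 ->
  transverse c0 c1 n0 -> transverse c1 c2 n1 ->
  transverse c2 c3 n2 -> transverse c3 c0 n3 ->
  sgz d *+ 2 * ((same_sign m0 m1 m2 m3)%:R - (same_sign n0 n1 n2 n3)%:R) =
  side_term c0 c1 (sgz c1 * sgz m0 * sgz n0) +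
    side_term c1 c2 (sgz c2 * sgz m1 * sgz n1)
  + side_term c2 c3 (sgz c3 * sgz m2 * sgz n2) +
      side_term c3 c0 (sgz c0 * sgz m3 * sgz n3).
Proof.
move=> z0 z1 z2 z3 sq; have e : c0 + c2 = c1 + c3 by case: sq.
move: m0 m1 m2 m3 n0 n1 n2 n3 d sq; rewrite /transverse /side_term.
pattern c0, c1, c2, c3; apply: square_ind z0 z1 z2 z3 e => {c0 c1 c2 c3}.
- move=> a b c d IH m0 m1 m2 m3 n0 n1 n2 n3 D /square_rot sq /square_rot sq' k0 k1
    k2 k3 t0 t1 t2 t3 u0 u1 u2 u3.
  have := IH m1 m2 m3 m0 n1 n2 n3 n0 D sq sq' k1 k2 k3 k0 t1 t2 t3 t0 u1 u2 u3 u0;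
    rewrite (same_sign_rot m0) (same_sign_rot n0) => ->.
  by rewrite addrC !addrA.
- move=> a b c d IH m0 m1 m2 m3 n0 n1 n2 n3 D /square_opp sq /square_opp sq' k0 k1
    k2 k3 t0 t1 t2 t3 u0 u1 u2 u3.
  have := IH m0 m1 m2 m3 n0 n1 n2 n3 (- D) sq sq'; rewrite !sgzN !eqr_opp !mulrNN.
  move=> /(_ k0 k1 k2 k3 t0 t1 t2 t3 u0 u1 u2 u3) h.
  by apply: oppr_inj; rewrite -mulNr -mulNrn h !opprD;
    do ![case: ifP => _]; rewrite ?mulNr ?oppr0.
- move=> a b c d a0 b0 c0 d0 m0 m1 m2 m3 n0 n1 n2 n3 D sq sq' *.
  rewrite (square_allpos sq) // (square_allpos sq') // subrr mulr0.
  by rewrite (gtr0_sgz a0) (gtr0_sgz b0) (gtr0_sgz c0) (gtr0_sgz d0).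
- move=> a b c d a0 b0 c0 d0 m0 m1 m2 m3 n0 n1 n2 n3 D sq sq' k0 k1 k2 k3.
  rewrite (ltr0_sgz a0) (gtr0_sgz b0) (gtr0_sgz c0) (gtr0_sgz d0) /= =>
    /(_ isT) t0 _ _ /(_ isT) t3 /(_ isT) u0 _ _ /(_ isT) u3.
  rewrite (same_sign_corner sq) // (same_sign_corner sq') //.
  have -> : sgz D = sgz (m3 * n0 - m0 * n3).
    by rewrite -[_ - _]opprB k0 -mulNr sgzM (@gtr0_sgz _ (- a)) ?oppr_gt0 ?mul1r.
  by rewrite sgz_minor //; ring.
- move=> a b c d a0 b0 c0 d0 m0 m1 m2 m3 n0 n1 n2 n3 D sq sq' k0 k1 k2 k3.
  rewrite (ltr0_sgz a0) (gtr0_sgz b0) (gtr0_sgz c0) (ltr0_sgz d0) /=.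
  move=> /(_ isT) t0 _ /(_ isT) t2 _ /(_ isT) u0 _ /(_ isT) u2 _.
  rewrite (same_sign_side sq) // (same_sign_side sq') //.
  have -> : sgz D = sgz (m2 * n0 - m0 * n2).
    have -> : m2 * n0 - m0 * n2 = (b - a) * D.
      case: sq => _ e1 _; case: sq' => _ e2 _.
      have -> : m2 = m1 + m3 - m0 by lra.
      have -> : n2 = n1 + n3 - n0 by lra.
      by rewrite [RHS]mulrBl -k0 -k1; ring.
    by rewrite sgzM (@gtr0_sgz _ (b - a)) ?mul1r // subr_gt0 (lt_trans a0).
  by rewrite sgz_minor //; ring.
Qed.

(** * Shadows of two segments *)

Definition o0 : 'I_3 := @Ordinal 3 0 isT.
Definition o1 : 'I_3 := @Ordinal 3 1 isT.
Definition o2 : 'I_3 := @Ordinal 3 2 isT.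

Lemma rV3P (R : realType) (a b : 'rV[R]_3) :
  a 0 o0 = b 0 o0 -> a 0 o1 = b 0 o1 -> a 0 o2 = b 0 o2 -> a = b.
Proof.
move=> h0 h1 h2; apply/rowP => -[[|[|[|//]]] i].
- by rewrite (_ : Ordinal i = o0) //; apply: val_inj.
- by rewrite (_ : Ordinal i = o1) //; apply: val_inj.
- by rewrite (_ : Ordinal i = o2) //; apply: val_inj.
Qed.

Lemma det3E (R : realType) (a b c : 'rV[R]_3) :
  det3 a b c = a 0 o0 * (b 0 o1 * c 0 o2 - b 0 o2 * c 0 o1)
    - a 0 o1 * (b 0 o0 * c 0 o2 - b 0 o2 * c 0 o0)
    + a 0 o2 * (b 0 o0 * c 0 o1 - b 0 o1 * c 0 o0).
Proof.
rewrite /det3 (expand_det_row _ ord0) !big_ord_recl big_ord0 /cofactor.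
rewrite !(expand_det_row _ ord0) !big_ord_recl !big_ord0 /cofactor.
rewrite !det_mx11 !mxE /= !expr0 !expr1 /bump /= ?addn0.
pose g (x : 'rV[R]_3) (i : nat) := nth 0 [:: x 0 o0; x 0 o1; x 0 o2] i.
have e (x : 'rV[R]_3) (i : 'I_3) : x 0 i = g x i.
  by case: i => [[|[|[|//]]] i]; rewrite /g /=; congr (x _ _); apply: val_inj.
by rewrite !e /bump /= /g /=; ring.
Qed.

(** A linear form in y that vanishes on the plane of v and u. *)
Definition side (R : realType) (v u y : 'rV[R]_3) : R := det3 v u y.

Ltac coords := rewrite /side !det3E ?mxE.

Lemma cramer3 (R : realType) (a b c z : 'rV[R]_3) :
  det3 a b c *: z = det3 z b c *: a + det3 a z c *: b + det3 a b z *: c.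
Proof. by apply: rV3P; coords; ring. Qed.

(** The differences of a point of s' and a point of s fill the parallelogram
    (patch) with corners corner0, ..., corner3.  The line spanned by v meets it iff
    the shadows of s and s' along v meet. *)
Definition corner0 (R : realType) (s s' : 'rV[R]_3 * 'rV[R]_3) := s'.1 - s.1.
Definition corner1 (R : realType) (s s' : 'rV[R]_3 * 'rV[R]_3) := s'.1 - s.2.
Definition corner2 (R : realType) (s s' : 'rV[R]_3 * 'rV[R]_3) := s'.2 - s.2.
Definition corner3 (R : realType) (s s' : 'rV[R]_3 * 'rV[R]_3) := s'.2 - s.1.

Lemma patch_square (R : realType) (v u : 'rV[R]_3) s s' :
  let y0 := corner0 s s' in let y1 := corner1 s s' in
  let y2 := corner2 s s' in let y3 := corner3 s s' in
  square_data (side v u y0) (side v u y1) (side v u y2) (side v u y3)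
   (det3 y0 y1 v) (det3 y1 y2 v) (det3 y2 y3 v) (det3 y3 y0 v).
Proof. by rewrite /corner0 /corner1 /corner2 /corner3; split; coords; ring. Qed.

Lemma side_swap (R : realType) (v u y : 'rV[R]_3) : side u v y = - side v u y.
Proof. by coords; ring. Qed.

Lemma patch_square_swap (R : realType) (v u : 'rV[R]_3) s s' :
  let y0 := corner0 s s' in let y1 := corner1 s s' in
  let y2 := corner2 s s' in let y3 := corner3 s s' in
  square_data (side v u y0) (side v u y1) (side v u y2) (side v u y3)
   (det3 y0 y1 u) (det3 y1 y2 u) (det3 y2 y3 u) (det3 y3 y0 u).
Proof.
move=> y0 y1 y2 y3; have := square_opp (patch_square u v s s').
by rewrite !(side_swap v u) !opprK.
Qed.

Lemma jacobi3 (R : realType) (v u a b c : 'rV[R]_3) :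
  det3 a b v * det3 b c u - det3 b c v * det3 a b u = side v u b * det3 a b c.
Proof. by coords; ring. Qed.

Lemma ratio_itv (R : realFieldType) (x y : R) :
  (0 < x) && (0 < y) || (x < 0) && (y < 0) -> 0 <= x / (x + y) <= 1.
Proof.
case/orP=> /andP[hx hy].
  have d : 0 < x + y by rewrite addr_gt0.
  by rewrite ler_pdivrMr // mul1r lerDl (ltW hy) andbT divr_ge0 // ltW.
have d : x + y < 0 by rewrite -oppr_gt0 opprD addr_gt0 ?oppr_gt0.
rewrite ler_ndivrMr // mul1r gerDl (ltW hy) andbT.
by rewrite mulr_le0 ?invr_le0 // ltW.
Qed.

Definition misses (R : realType) (v y y' : 'rV[R]_3) : Prop :=
  forall t h : R, 0 <= t <= 1 -> (1 - t) *: y + t *: y' <> h *: v.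

(** If the determinant vanished, the point where the edge crosses the plane of v
    and u would be a multiple of v. *)
Lemma misses_transverse (R : realType) (v u y y' : 'rV[R]_3) :
  misses v y y' -> side v u y != 0 -> side v u y' != 0 ->
  transverse (side v u y) (side v u y') (det3 y y' v).
Proof.
move=> miss c0 c0' sg; apply/eqP => m0.
set c := side v u y in c0 sg; set c' := side v u y' in c0' sg.
have d0 : c - c' != 0 by apply: contra sg; rewrite subr_eq0 => /eqP->.
pose t := c / (c - c').
have tI : 0 <= t <= 1.
  apply: ratio_itv; rewrite oppr_gt0 oppr_lt0.
  by move: sg c0 c0'; case: (sgzP c) => // hc; case: (sgzP c').
pose z := (1 - t) *: y + t *: y'.
have t1 : 1 - t = - c' / (c - c') by rewrite /t; field.
have zE : (c - c') *: z = c *: y' - c' *: y.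
  apply: rV3P; rewrite !mxE t1 /t; field => //.
have zu : det3 v u z = 0.
  apply: (mulfI d0); rewrite mulr0.
  transitivity (det3 v u ((c - c') *: z)); first by coords; ring.
  by rewrite zE /c /c'; coords; ring.
have zy : det3 v z y = 0.
  apply: (mulfI d0); rewrite mulr0.
  transitivity (det3 v ((c - c') *: z) y); first by coords; ring.
  by rewrite zE; transitivity (- c * det3 y y' v);
    [coords; ring | rewrite m0 mulr0].
apply: (miss t (det3 z u y / c)) => //.
apply: (scalerI c0); rewrite -/z {1}/c /side cramer3 zu zy !scale0r !addr0 scalerA.
by rewrite mulrC divfK.
Qed.

Definition patch_regular (R : realType) (v : 'rV[R]_3) s s' : Prop :=
  [/\ misses v (corner0 s s') (corner1 s s'),
    misses v (corner1 s s') (corner2 s s'),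
    misses v (corner2 s s') (corner3 s s') & misses v (corner3 s s')
      (corner0 s s')].

Definition patch_generic (R : realType) (v u : 'rV[R]_3) s s' : Prop :=
  [/\ side v u (corner0 s s') != 0, side v u (corner1 s s') != 0,
    side v u (corner2 s s') != 0 & side v u (corner3 s s') != 0].

(** By Cramer's rule the position of the common point in the parallelogram is given
    by the quotients of the four determinants by the sum of two opposite ones.  The
    second direction u excludes that this sum vanishes, that is, that the shadows are
    parallel and overlap. *)
Lemma shadows_meetE (R : realType) (v u : 'rV[R]_3) s s' :
  patch_regular v s s' -> patch_generic v u s s' ->
  `[< shadows_meet v s s' >] =
  same_sign (det3 (corner0 s s') (corner1 s s') v)
    (det3 (corner1 s s') (corner2 s s') v)
   (det3 (corner2 s s') (corner3 s s') v) (det3 (corner3 s s') (corner0 s s') v).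
Proof.
move=> [r0 r1 r2 r3] [g0 g1 g2 g3]; apply/asboolP/idP; last first.
  move=> ss.
  set y0 := corner0 s s'; pose a := corner1 s s' - y0; pose b := corner3 s s' - y0.
  pose J := det3 a b v.
  have J02 : J = det3 (corner0 s s') (corner1 s s') v +
    det3 (corner2 s s') (corner3 s s') v.
    by rewrite /J /a /b /y0 /corner0 /corner1 /corner2 /corner3; coords; ring.
  have J13 : J = det3 (corner1 s s') (corner2 s s') v +
    det3 (corner3 s s') (corner0 s s') v.
    by rewrite /J /a /b /y0 /corner0 /corner1 /corner2 /corner3; coords; ring.
  have J0 : J != 0 by rewrite J02; apply/eqP; case/orP: ss => /and4P[? _ ? _] ?;
    lra.
  exists (det3 (corner3 s s') (corner0 s s') v / J),
    (det3 (corner0 s s') (corner1 s s') v / J), (det3 a b y0 / J).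
  split.
  - rewrite J13 addrC; apply: ratio_itv.
    by case/orP: ss => /and4P[h0 h1 h2 h3]; rewrite ?(h0, h1, h2, h3) ?orbT.
  - rewrite J02; apply: ratio_itv.
    by case/orP: ss => /and4P[h0 h1 h2 h3]; rewrite ?(h0, h1, h2, h3) ?orbT.
  - apply: (scalerI J0).
    transitivity (J *: y0 + det3 (corner3 s s') (corner0 s s') v *: a +
      det3 (corner0 s s') (corner1 s s') v *: b).
      rewrite /segment_point /a /b /y0 /corner0 /corner1 /corner2 /corner3.
      by apply: rV3P; rewrite !mxE; field.
    rewrite scalerA mulrC divfK // /J cramer3.
    have -> : det3 (corner3 s s') (corner0 s s') v = - det3 y0 b v.
      by rewrite /b /y0; coords; ring.
    have -> : det3 (corner0 s s') (corner1 s s') v = - det3 a y0 v.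
      by rewrite /a /y0; coords; ring.
    by rewrite !scaleNr addrC !addrA addrC; apply: rV3P; rewrite !mxE; ring.
case=> t [t' [h [tI t'I]]] zE.
have [T0 T1 T2 T3] := And4 (misses_transverse r0 g0 g1) (misses_transverse r1 g1 g2)
  (misses_transverse r2 g2 g3) (misses_transverse r3 g3 g0).
pose J := det3 (corner1 s s' - corner0 s s') (corner3 s s' - corner0 s s') v.
pose m a b := det3 a b v.
have m0E : m (corner0 s s') (corner1 s s') = t' * J.
  apply/eqP; rewrite -subr_eq0; apply/eqP.
  transitivity (det3 (h *: v) (corner1 s s' - corner0 s s') v); last by coords;
    ring.
  by rewrite -zE /segment_point /m /J /corner0 /corner1 /corner3; coords; ring.
have m3E : m (corner3 s s') (corner0 s s') = t * J.
  apply/eqP; rewrite -subr_eq0; apply/eqP.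
  transitivity (det3 (corner3 s s' - corner0 s s') (h *: v) v); last by coords;
    ring.
  by rewrite -zE /segment_point /m /J /corner0 /corner1 /corner3; coords; ring.
have m2E : m (corner2 s s') (corner3 s s') = (1 - t') * J.
  by rewrite mulrBl mul1r -m0E /m /J /corner0 /corner1 /corner2 /corner3; coords;
    ring.
have m1E : m (corner1 s s') (corner2 s s') = (1 - t) * J.
  by rewrite mulrBl mul1r -m3E /m /J /corner0 /corner1 /corner2 /corner3; coords;
    ring.
rewrite -!/(m _ _) in T0 T1 T2 T3 *.
have cE : (1 - t) * (1 - t') * side v u (corner0 s s') +
  t * (1 - t') * side v u (corner1 s s')
   + t * t' * side v u (corner2 s s') + (1 - t) * t' * side v u (corner3 s s') = 0.
  transitivity (side v u (h *: v)); last by coords; ring.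
  by rewrite -zE /segment_point /corner0 /corner1 /corner2 /corner3; coords; ring.
have nt0 : t != 0.
  apply/eqP => t0; apply: (r3 (1 - t') h); first by lra.
  by rewrite -zE t0 /segment_point /corner0 /corner3; apply: rV3P; rewrite !mxE;
    ring.
have nt1 : t != 1.
  apply/eqP => t1; apply: (r1 t' h); first by lra.
  by rewrite -zE t1 /segment_point /corner1 /corner2; apply: rV3P; rewrite !mxE;
    ring.
have nt'0 : t' != 0.
  apply/eqP => t0; apply: (r0 t h); first by lra.
  by rewrite -zE t0 /segment_point /corner0 /corner1; apply: rV3P; rewrite !mxE;
    ring.
have nt'1 : t' != 1.
  apply/eqP => t1; apply: (r2 (1 - t) h); first by lra.
  by rewrite -zE t1 /segment_point /corner2 /corner3; apply: rV3P; rewrite !mxE;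
    ring.
have t_gt0 : 0 < t by rewrite lt_neqAle eq_sym nt0; case/andP: tI.
have t_lt1 : 0 < 1 - t by rewrite subr_gt0 lt_neqAle nt1; case/andP: tI.
have t'_gt0 : 0 < t' by rewrite lt_neqAle eq_sym nt'0; case/andP: t'I.
have t'_lt1 : 0 < 1 - t' by rewrite subr_gt0 lt_neqAle nt'1; case/andP: t'I.
rewrite /same_sign m0E m1E m2E m3E.
(* If J = 0, the ends of each edge lie on the same side of the plane of v and u;
   but the plane contains an interior point of the parallelogram. *)
case: (ltgtP J 0) => [JN|JP|J0]; last 1 first.
- have w0 := mulr_gt0 t_lt1 t'_lt1; have w1 := mulr_gt0 t_gt0 t'_lt1.
  have w2 := mulr_gt0 t_gt0 t'_gt0; have w3 := mulr_gt0 t_lt1 t'_gt0.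
  move: cE; move: w0 w1 w2 w3.
  move: ((1 - t) * (1 - t')) (t * (1 - t')) (t * t') ((1 - t) * t') =>
    a0 a1 a2 a3 w0 w1 w2 w3.
  move: T0 T1 T2 T3; rewrite m0E m1E m2E m3E J0 !mulr0 /transverse eqxx.
  move: g0; move: (side v u (corner0 _ _)) (side v u (corner1 _ _))
    (side v u (corner2 _ _)) (side v u (corner3 _ _)) => c0 c1 c2 c3 z0.
  have T (x y : int) : (x != y -> ~~ true) -> x =
    y by case: eqVneq => // _ /(_ isT).
  move=> /T e0 /T e1 /T e2 _ cE; exfalso.
  move: z0; case: (sgzP c0) e0 => // hc0 /esym/eqP.
  + rewrite sgz_cp0 => hc1 _; move/eqP: e1;
      rewrite gtr0_sgz // eq_sym sgz_cp0 => hc2.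
    move/eqP: e2; rewrite gtr0_sgz // eq_sym sgz_cp0 => hc3.
    suff : 0 < a0 * c0 + a1 * c1 + a2 * c2 + a3 * c3 by rewrite cE ltxx.
    by rewrite !addr_gt0 // mulr_gt0.
  + rewrite sgz_cp0 => hc1 _; move/eqP: e1;
      rewrite ltr0_sgz // eq_sym sgz_cp0 => hc2.
    move/eqP: e2; rewrite ltr0_sgz // eq_sym sgz_cp0 => hc3.
    suff : 0 < - (a0 * c0 + a1 * c1 + a2 * c2 + a3 * c3) by rewrite cE oppr0 ltxx.
    by rewrite !opprD !addr_gt0 // oppr_gt0 pmulr_rlt0.
- by rewrite !(nmulr_llt0 _ JN) t_gt0 t'_gt0 t_lt1 t'_lt1 orbT.
- by rewrite !(pmulr_lgt0 _ JP) t_gt0 t'_gt0 t_lt1 t'_lt1.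
Qed.

(** * Crossing signs of two segments *)

Definition signed_crossing (R : realType) (v : 'rV[R]_3) s s' : int :=
  if `[< shadows_meet v s s' >] then crossing_sign s s' else 0.

(** The sign of the crossing of the two shadows in the plane, whichever of the two
    segments is the upper one. *)
Definition planar_crossing (R : realType) (v : 'rV[R]_3) s s' : int :=
  if `[< shadows_meet v s s' >] then sgz (det3 (s'.2 - s'.1) (s.2 - s.1) v) else 0.

(** The two signs agree iff s' lies above s with respect to v, so these are the
    crossings at which s' is the upper strand. *)
Definition over_crossing (R : realType) (v : 'rV[R]_3) s s' : int :=
  if signed_crossing v s s' == planar_crossing v s s' then signed_crossing v s
    s' else 0.

Definition flip (T : Type) (s : T * T) : T * T := (s.2, s.1).

Definition apart (R : realType) (s s' : 'rV[R]_3 * 'rV[R]_3) : Prop :=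
  forall t t' : R, 0 <= t <= 1 -> 0 <= t' <= 1 ->
    segment_point s t <> segment_point s' t'.

Lemma segment_point_flip (R : realType) (s : 'rV[R]_3 * 'rV[R]_3) (t : R) :
  segment_point (flip s) t = segment_point s (1 - t).
Proof. by rewrite /segment_point /= opprB addrCA subrr addr0 addrC. Qed.

Lemma shadows_meet_flip (R : realType) (v : 'rV[R]_3) s s' :
  shadows_meet v (flip s) s' <-> shadows_meet v s s'.
Proof.
suff h s0 : shadows_meet v s0 s' -> shadows_meet v (flip s0) s'.
  by split=> [/h|/h//]; rewrite /flip /=; case: s.
case=> t [t' [h [tI t'I E]]]; exists (1 - t), t', h; split=> //; first by lra.
by rewrite segment_point_flip opprB addrCA subrr addr0.
Qed.

Lemma shadows_meet_sym (R : realType) (v : 'rV[R]_3) s s' :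
  shadows_meet v s' s <-> shadows_meet v s s'.
Proof.
suff h s0 s0' : shadows_meet v s0' s0 -> shadows_meet v s0 s0' by split; apply: h.
case=> t [t' [h [tI t'I E]]]; exists t', t, (- h); split=> //.
by rewrite scaleNr -E opprB.
Qed.

Lemma signed_crossing_flip (R : realType) (v : 'rV[R]_3) s s' :
  signed_crossing v (flip s) s' = - signed_crossing v s s'.
Proof.
rewrite /signed_crossing (asbool_equiv_eq (shadows_meet_flip v s s')).
case: ifP => _; rewrite ?oppr0 // /crossing_sign -sgzN /=; congr sgz.
by coords; ring.
Qed.

Lemma signed_crossing_sym (R : realType) (v : 'rV[R]_3) s s' :
  signed_crossing v s' s = signed_crossing v s s'.
Proof.
rewrite /signed_crossing (asbool_equiv_eq (shadows_meet_sym v s s')).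
by case: ifP => _ //; rewrite /crossing_sign; congr sgz; coords; ring.
Qed.

Lemma planar_crossing_flip (R : realType) (v : 'rV[R]_3) s s' :
  planar_crossing v (flip s) s' = - planar_crossing v s s'.
Proof.
rewrite /planar_crossing (asbool_equiv_eq (shadows_meet_flip v s s')).
case: ifP => _; rewrite ?oppr0 // -sgzN /=; congr sgz.
by coords; ring.
Qed.

Lemma planar_crossing_sym (R : realType) (v : 'rV[R]_3) s s' :
  planar_crossing v s' s = - planar_crossing v s s'.
Proof.
rewrite /planar_crossing (asbool_equiv_eq (shadows_meet_sym v s s')).
by case: ifP => _; rewrite ?oppr0 // -sgzN; congr sgz; coords; ring.
Qed.

Lemma over_crossing_flip (R : realType) (v : 'rV[R]_3) s s' :
  over_crossing v (flip s) s' = - over_crossing v s s'.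
Proof.
rewrite /over_crossing signed_crossing_flip planar_crossing_flip eqr_opp.
by case: ifP; rewrite ?oppr0.
Qed.

Lemma over_crossing_flipr (R : realType) (v : 'rV[R]_3) s s' :
  over_crossing v s (flip s') = - over_crossing v s s'.
Proof.
rewrite /over_crossing -signed_crossing_sym signed_crossing_flip
  signed_crossing_sym.
rewrite -[planar_crossing v s _]opprK -planar_crossing_sym planar_crossing_flip
  opprK.
rewrite -[planar_crossing v s' s]opprK -planar_crossing_sym eqr_opp.
by case: ifP; rewrite ?oppr0.
Qed.

(** The two signs differ by the sign of the height of s' over s at the crossing,
    which is nonzero because the segments are apart. *)
Lemma over_crossing_double (R : realType) (v : 'rV[R]_3) s s' :
  apart s s' ->
  signed_crossing v s s' + planar_crossing v s s' = over_crossing v s s' *+ 2.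
Proof.
move=> ap; rewrite /over_crossing.
suff : signed_crossing v s s' = planar_crossing v s s' \/
    signed_crossing v s s' = - planar_crossing v s s'.
  case=> ->; first by rewrite eqxx mulr2n.
  by rewrite addNr; case: eqP => [e|_]; rewrite ?mul0rn // mulr2n {1}e subrr.
rewrite /signed_crossing /planar_crossing;
  case: asboolP => [[t [t' [h [tI t'I E]]]]|]; last by left.
have hN0 : h != 0.
  apply/eqP => h0; apply: (ap t t' tI t'I).
  by apply/esym/eqP; rewrite -subr_eq0 E h0 scale0r.
have -> : crossing_sign s s' = sgz h * sgz (det3 (s'.2 - s'.1) (s.2 - s.1) v).
  rewrite /crossing_sign -sgzM; congr sgz.
  transitivity (det3 (s'.2 - s'.1) (s.2 - s.1) (h *: v)); last by coords; ring.
  by rewrite -E /segment_point; coords; ring.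
by move: hN0; case: (sgzP h) => // _ _;
  [left; rewrite mul1r | right; rewrite mulN1r].
Qed.

(** The contribution of a boundary edge in square_planar. *)
Definition planar_term (R : realType) (v u y y' : 'rV[R]_3) : int :=
  side_term (side v u y) (side v u y') (sgz (det3 y y' v)).

(** Twice the contribution of a boundary edge in square_rotation. *)
Definition turning_term (R : realType) (v u y y' : 'rV[R]_3) : int :=
  (sgz (side v u y') - sgz (side v u y)) * (sgz (det3 y y' v) * sgz (det3 y y' u)).

Definition patch_sum (R : realType) (k : 'rV[R]_3 -> 'rV[R]_3 -> int)
    (s s' : 'rV[R]_3 * 'rV[R]_3) : int :=
  k (corner0 s s') (corner1 s s') + k (corner1 s s') (corner2 s s')
  + k (corner2 s s') (corner3 s s') + k (corner3 s s') (corner0 s s').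

Lemma det3_swap (R : realType) (a b c : 'rV[R]_3) : det3 b a c = - det3 a b c.
Proof. by coords; ring. Qed.

Lemma planar_term_anti (R : realType) (v u y y' : 'rV[R]_3) : planar_term v u y' y =
  - planar_term v u y y'.
Proof.
by rewrite /planar_term /side_term det3_swap sgzN eq_sym; case: ifP; rewrite ?oppr0.
Qed.

Lemma planar_term_opp (R : realType) (v u y y' : 'rV[R]_3) :
  planar_term v u (- y) (- y') = planar_term v u y y'.
Proof.
have e z : side v u (- z) = - side v u z by coords; ring.
rewrite /planar_term !e /side_term !sgzN eqr_opp; congr (if _ then _ else sgz _).
by coords; ring.
Qed.

Lemma turning_term_anti (R : realType) (v u y y' : 'rV[R]_3) : turning_term v u
  y' y = - turning_term v u y y'.
Proof. by rewrite /turning_term ![det3 y' y _]det3_swap !sgzN; ring. Qed.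

Lemma planar_crossing_patch (R : realType) (v u : 'rV[R]_3) s s' :
  patch_regular v s s' -> patch_generic v u s s' ->
  planar_crossing v s s' *+ 2 = patch_sum (planar_term v u) s s'.
Proof.
move=> reg gen; have [r0 r1 r2 r3] := reg; have [g0 g1 g2 g3] := gen.
rewrite /patch_sum /planar_term -square_planar //; last first.
all: try exact: misses_transverse.
  exact: patch_square.
rewrite /planar_crossing (shadows_meetE reg gen);
  congr ((if _ then sgz _ else _) *+ 2).
by rewrite /corner0 /corner1 /corner2 /corner3; coords; ring.
Qed.

Lemma side_termE (R : realFieldType) (c c' : R) (e : int) :
  c != 0 -> c' != 0 -> side_term c c' (sgz c' * e) *+ 2 = (sgz c' - sgz c) * e.
Proof.
by rewrite /side_term; case: (sgzP c) => // _ _; case: (sgzP c') => // _ _ /=;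
  rewrite ?subrr ?mul0r ?mul0rn //; ring.
Qed.

(** Turning the direction of projection from v to u changes the sign of a crossing
    by boundary terms only, which is what makes the linking number invariant. *)
Lemma signed_crossing_patch (R : realType) (v u : 'rV[R]_3) s s' :
  patch_regular v s s' -> patch_regular u s s' -> patch_generic v u s s' ->
  (signed_crossing v s s' - signed_crossing u s s') *+ 4 =
    - patch_sum (turning_term v u) s s'.
Proof.
move=> regv regu gen; have gen' : patch_generic u v s s'.
  by case: gen => *; split; rewrite side_swap oppr_eq0.
rewrite /signed_crossing (shadows_meetE regv gen) (shadows_meetE regu gen').
have [g0 g1 g2 g3] := gen; have [r0 r1 r2 r3] := regv; have [q0 q1 q2 q3] := regu.
have [t0 t1 t2 t3] := And4 (misses_transverse r0 g0 g1) (misses_transverse r1 g1 g2)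
  (misses_transverse r2 g2 g3) (misses_transverse r3 g3 g0).
have tr y y' : misses u y y' -> side v u y != 0 -> side v u y' != 0 ->
    transverse (side v u y) (side v u y') (det3 y y' u).
  rewrite !(side_swap u v) !oppr_eq0 /transverse !sgzN eqr_opp.
  exact: misses_transverse.
have [w0 w1 w2 w3] := And4 (tr _ _ q0 g0 g1) (tr _ _ q1 g1 g2) (tr _ _ q2 g2 g3)
  (tr _ _ q3 g3 g0).
pose d := det3 (s.2 - s.1) (s'.2 - s'.1) (s.1 - s'.1).
have J i j k : det3 i j v * det3 j k u - det3 j k v * det3 i j u =
  side v u j * det3 i j k
  by exact: jacobi3.
have k0 : det3 (corner0 s s') (corner1 s s') v * det3 (corner3 s s') (corner0 s s')
  u -
    det3 (corner3 s s') (corner0 s s') v * det3 (corner0 s s') (corner1 s s') u =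
      side v u (corner0 s s') * - d.
  by rewrite -opprB J mulrN; congr (- (_ * _));
    rewrite /d /corner0 /corner1 /corner3; coords; ring.
have k1 : det3 (corner1 s s') (corner2 s s') v * det3 (corner0 s s') (corner1 s s')
  u -
    det3 (corner0 s s') (corner1 s s') v * det3 (corner1 s s') (corner2 s s') u =
      side v u (corner1 s s') * - d.
  by rewrite -opprB J mulrN; congr (- (_ * _));
    rewrite /d /corner0 /corner1 /corner2; coords; ring.
have k2 : det3 (corner2 s s') (corner3 s s') v * det3 (corner1 s s') (corner2 s s')
  u -
    det3 (corner1 s s') (corner2 s s') v * det3 (corner2 s s') (corner3 s s') u =
      side v u (corner2 s s') * - d.
  by rewrite -opprB J mulrN; congr (- (_ * _));
    rewrite /d /corner3 /corner1 /corner2; coords; ring.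
have k3 : det3 (corner3 s s') (corner0 s s') v * det3 (corner2 s s') (corner3 s s')
  u -
    det3 (corner2 s s') (corner3 s s') v * det3 (corner3 s s') (corner0 s s') u =
      side v u (corner3 s s') * - d.
  by rewrite -opprB J mulrN; congr (- (_ * _));
    rewrite /d /corner3 /corner0 /corner2; coords; ring.
have := square_rotation g0 g1 g2 g3 (patch_square v u s s')
  (patch_square_swap v u s s')
  k0 k1 k2 k3 t0 t1 t2 t3 w0 w1 w2 w3.
move=> /(congr1 (fun x => - (x *+ 2))).
rewrite !mulrnDl -!mulrA !side_termE // -/(turning_term _ _ _ _) => h.
rewrite /patch_sum -h /crossing_sign -/d sgzN.
by do 2!case: ifP => _ /=; ring.
Qed.

(** The only property of a polygonal path from x to y that matters: sums of
    differences telescope along it. *)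
Definition polyline (R : realType) (S : seq ('rV[R]_3 * 'rV[R]_3))
  (x y : 'rV[R]_3) : Prop :=
  forall h : 'rV[R]_3 -> int, \sum_(s <- S) (h s.2 - h s.1) = h y - h x.

(** Adjacent patches induce opposite orientations on their common edge, so that only
    edges on the boundary of the grid of all patches remain. *)
Lemma patch_sum_arcs (R : realType) (k : 'rV[R]_3 -> 'rV[R]_3 -> int) S
  S' (x y z w : 'rV[R]_3) :
  (forall a b, k b a = - k a b) -> polyline S x y -> polyline S' z w ->
  \sum_(s <- S) \sum_(s' <- S') patch_sum k s s' =
  \sum_(s <- S) (k (z - s.1) (z - s.2) - k (w - s.1) (w - s.2))
  + \sum_(s' <- S') (k (s'.1 - y) (s'.2 - y) - k (s'.1 - x) (s'.2 - x)).
Proof.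
move=> anti aS aS'.
transitivity (\sum_(s <- S) \sum_(s' <- S')
    (- (k (s'.2 - s.1) (s'.2 - s.2) - k (s'.1 - s.1) (s'.1 - s.2))
     + (k (s'.1 - s.2) (s'.2 - s.2) - k (s'.1 - s.1) (s'.2 - s.1)))).
  apply: eq_bigr => s _; apply: eq_bigr => s' _.
  rewrite /patch_sum /corner0 /corner1 /corner2 /corner3.
  by rewrite [k (s'.2 - s.2) _]anti [k (s'.2 - s.1) (s'.1 - _)]anti; ring.
under eq_bigr do rewrite big_split /= sumrN (aS' (fun q => k (q - _) (q - _)))
  opprB.
rewrite big_split /=; congr (_ + _).
rewrite exchange_big; apply: eq_bigr => s' _.
exact: (aS (fun p => k (s'.1 - p) (s'.2 - p))).
Qed.

(** * Generic directions of projection *)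

Definition dot (R : realType) (a b : 'rV[R]_3) : R :=
  a 0 o0 * b 0 o0 + a 0 o1 * b 0 o1 + a 0 o2 * b 0 o2.

(** A property holds generically if it holds outside finitely many planes through
    the origin; ns lists their normal vectors. *)
Definition generically (R : realType) (P : 'rV[R]_3 -> Prop) : Prop :=
  exists2 ns : seq 'rV[R]_3, 0 \notin ns &
    forall v, (forall n, n \in ns -> dot n v != 0) -> P v.

Lemma poly_nonroot (R : numFieldType) (p : {poly R}) : p != 0 -> exists t,
  p.[t] != 0.
Proof.
move=> p0; pose rs : seq R := [seq k%:R | k <- iota 0 (size p)].
have urs : uniq rs.
  by rewrite map_inj_uniq ?iota_uniq // => i j /eqP; rewrite eqr_nat => /eqP.
case: (boolP (all (root p) rs)) => [h|/allPn[t _ ht]]; last by exists t.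
by have := max_poly_roots p0 h urs; rewrite size_map size_iota ltnn.
Qed.

(** The curve (1, t, t ^ 2) has only finitely many points on each plane through the
    origin. *)
Lemma generically_ex (R : realType) (P : 'rV[R]_3 -> Prop) :
  generically P -> exists v, P v.
Proof.
case=> ns ns0 H.
pose pn (n : 'rV[R]_3) : {poly R} := Poly [:: n 0 o0; n 0 o1; n 0 o2].
have pn0 n : n != 0 -> pn n != 0.
  apply: contra => /eqP e; apply/eqP; apply: rV3P; rewrite !mxE.
  - by rewrite -[LHS](coef_Poly [:: n 0 o0; n 0 o1; n 0 o2] 0) -/(pn n) e coef0.
  - by rewrite -[LHS](coef_Poly [:: n 0 o0; n 0 o1; n 0 o2] 1) -/(pn n) e coef0.
  - by rewrite -[LHS](coef_Poly [:: n 0 o0; n 0 o1; n 0 o2] 2) -/(pn n) e coef0.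
have p0 : \prod_(n <- ns) pn n != 0.
  rewrite prodf_seq_neq0; apply/allP => n nns /=; apply: pn0.
  by apply: contraNneq ns0 => <-.
have [t ht] := poly_nonroot p0.
exists (\row_j t ^+ j); apply: H => n nns.
rewrite horner_prod prodf_seq_neq0 in ht.
have /= := allP ht n nns; apply: contra => /eqP e.
by rewrite /pn horner_Poly /= -[X in _ == X]e /dot !mxE /=; apply/eqP; ring.
Qed.

Lemma generically_imp (R : realType) (P Q : 'rV[R]_3 -> Prop) :
  (forall v, P v -> Q v) -> generically P -> generically Q.
Proof. by move=> PQ [ns ns0 H]; exists ns => // v /H/PQ. Qed.

Lemma generically_and (R : realType) (P Q : 'rV[R]_3 -> Prop) :
  generically P -> generically Q -> generically (fun v => P v /\ Q v).
Proof.
move=> [ns ns0 H] [ms ms0 K]; exists (ns ++ ms);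
  first by rewrite mem_cat negb_or ns0.
by move=> v h; split; [apply: H | apply: K] => n ?; apply: h; rewrite mem_cat;
  apply/orP; [left|right].
Qed.

Lemma generically_all (R : realType) (T : eqType) (s : seq T)
  (P : T -> 'rV[R]_3 -> Prop) :
  (forall x, x \in s -> generically (P x)) ->
  generically (fun v => forall x, x \in s -> P x v).
Proof.
elim: s => [|x s IH] H; first by exists [::].
have gx : generically (P x) by apply: H; rewrite mem_head.
have gs := IH (fun y ys => H y (mem_behead (s := x :: s) ys)).
apply: generically_imp (generically_and gx gs) => v [h1 h2] y.
by rewrite inE => /predU1P[-> //|]; apply: h2.
Qed.

Lemma generically_nonzero (R : realType) : @generically R (fun v => v != 0).
Proof.
exists [:: const_mx 1]; first rewrite inE eq_sym; last first.
  by move=> v /(_ _ (mem_head _ _)); apply: contraNneq => ->; rewrite /dot !mxE;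
    apply/eqP; ring.
by apply/eqP => /rowP /(_ o0); rewrite !mxE => /eqP; rewrite oner_eq0.
Qed.

(** It is enough that v avoids a plane through y, y' and the origin. *)
Lemma generically_misses (R : realType) (y y' : 'rV[R]_3) :
  (forall t, 0 <= t <= 1 -> (1 - t) *: y + t *: y' <> 0) ->
  generically (fun v => misses v y y').
Proof.
move=> seg0; pose A := (col_mx y y')^T.
pose n := nz_row (kermx A).
have n0 : n != 0.
  rewrite nz_row_eq0 -mxrank_eq0 mxrank_ker subn_eq0 -ltnNge.
  exact: leq_ltn_trans (rank_leq_col _) _.
have nA : n *m A = 0 by apply/sub_kermxP; rewrite nz_row_sub.
have dotE (z : 'rV[R]_3) : dot n z = (n *m z^T) 0 0.
  rewrite !mxE !big_ord_recl big_ord0 /= addr0 !mxE addrA /dot.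
  by congr (n 0 _ * z 0 _ + n 0 _ * z 0 _ + n 0 _ * z 0 _); apply: val_inj.
have ny : dot n y = 0.
  have := congr1 (fun M : 'M_(_, _) => M 0 (lshift 1 0)) nA.
  rewrite /A tr_col_mx mul_mx_row row_mxEl !mxE dotE => <-; rewrite !mxE //.
have ny' : dot n y' = 0.
  have := congr1 (fun M : 'M_(_, _) => M 0 (rshift 1 0)) nA.
  rewrite /A tr_col_mx mul_mx_row row_mxEr !mxE dotE => <-; rewrite !mxE //.
exists [:: n]; first by rewrite inE eq_sym.
move=> v /(_ _ (mem_head _ _)) nv t h tI E.
have : h * dot n v = 0.
  transitivity (dot n (h *: v)); first by rewrite /dot !mxE; ring.
  rewrite -E; transitivity ((1 - t) * dot n y + t * dot n y').
    by rewrite /dot !mxE; ring.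
  by rewrite ny ny' !mulr0 addr0.
move/eqP; rewrite mulf_eq0 (negbTE nv) orbF => /eqP h0.
by apply: (seg0 t tI); rewrite E h0 scale0r.
Qed.

Lemma generically_side (R : realType) (v y : 'rV[R]_3) :
  v != 0 -> (forall h, y <> h *: v) -> generically (fun u => side v u y != 0).
Proof.
move=> v0 yv.
pose n : 'rV[R]_3 := \row_j nth 0 [:: y 0 o1 * v 0 o2 - y 0 o2 * v 0 o1;
  y 0 o2 * v 0 o0 - y 0 o0 * v 0 o2; y 0 o0 * v 0 o1 - y 0 o1 * v 0 o0] j.
exists [:: n]; last first.
  move=> u /(_ _ (mem_head _ _)); apply: contra => /eqP h; apply/eqP.
  by rewrite -h /dot !mxE /=; coords; ring.
rewrite inE eq_sym; apply/eqP => nE.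
have e0 : y 0 o1 * v 0 o2 = y 0 o2 * v 0 o1.
  by have := congr1 (fun M : 'rV_3 => M 0 o0) nE; rewrite !mxE /= => /eqP;
    rewrite subr_eq0 => /eqP.
have e1 : y 0 o2 * v 0 o0 = y 0 o0 * v 0 o2.
  by have := congr1 (fun M : 'rV_3 => M 0 o1) nE; rewrite !mxE /= => /eqP;
    rewrite subr_eq0 => /eqP.
have e2 : y 0 o0 * v 0 o1 = y 0 o1 * v 0 o0.
  by have := congr1 (fun M : 'rV_3 => M 0 o2) nE; rewrite !mxE /= => /eqP;
    rewrite subr_eq0 => /eqP.
have {v0} : [|| v 0 o0 != 0, v 0 o1 != 0 | v 0 o2 != 0].
  apply: contraNT v0; rewrite !negb_or !negbK => /and3P[/eqP h0 /eqP h1 /eqP h2].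
  by apply/eqP; apply: rV3P; rewrite mxE.
case/or3P=> vk.
- apply: (yv (y 0 o0 / v 0 o0)); apply: rV3P; rewrite !mxE; apply: (mulIf vk);
  rewrite mulrAC divfK //.
- apply: (yv (y 0 o1 / v 0 o1)); apply: rV3P; rewrite !mxE; apply: (mulIf vk);
  rewrite mulrAC divfK //.
- apply: (yv (y 0 o2 / v 0 o2)); apply: rV3P; rewrite !mxE; apply: (mulIf vk);
  rewrite mulrAC divfK //.
Qed.

Lemma generically_patch_regular (R : realType) (s s' : 'rV[R]_3 * 'rV[R]_3) :
  apart s s' -> generically (fun v => patch_regular v s s').
Proof.
move=> ap.
have I0 : 0 <= (0 : R) <= 1 by rewrite lexx ler01.
have I1 : 0 <= (1 : R) <= 1 by rewrite lexx ler01.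
have I (t : R) : 0 <= t <= 1 -> 0 <= 1 - t <= 1 by move=> ?; lra.
have key (t t' : R) z : 0 <= t <= 1 -> 0 <= t' <= 1 ->
    z = segment_point s' t' - segment_point s t -> z <> 0.
  move=> tI t'I -> /eqP; rewrite subr_eq0 => /eqP e.
  by apply: (ap t t').
have g0 : generically (fun v => misses v (corner0 s s') (corner1 s s')).
  apply: generically_misses => t tI; apply: (key t 0) => //.
  by rewrite /segment_point /corner0 /corner1; apply: rV3P; rewrite !mxE; ring.
have g1 : generically (fun v => misses v (corner1 s s') (corner2 s s')).
  apply: generically_misses => t tI; apply: (key 1 t) => //.
  by rewrite /segment_point /corner1 /corner2; apply: rV3P; rewrite !mxE; ring.
have g2 : generically (fun v => misses v (corner2 s s') (corner3 s s')).
  apply: generically_misses => t tI; apply: (key (1 - t) 1) => //; first exact: I.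
  by rewrite /segment_point /corner2 /corner3; apply: rV3P; rewrite !mxE; ring.
have g3 : generically (fun v => misses v (corner3 s s') (corner0 s s')).
  apply: generically_misses => t tI; apply: (key 0 (1 - t)) => //; first exact: I.
  by rewrite /segment_point /corner3 /corner0; apply: rV3P; rewrite !mxE; ring.
apply: generically_imp (generically_and (generically_and g0 g1)
  (generically_and g2 g3)).
by move=> v [[? ?] [? ?]]; split.
Qed.

Lemma generically_patch_generic (R : realType) (v : 'rV[R]_3) s s' :
  v != 0 -> patch_regular v s s' -> generically (fun u => patch_generic v u s s').
Proof.
move=> v0 [r0 r1 r2 r3].
have g y y' : misses v y y' -> generically (fun u => side v u y != 0).
  move=> m; apply: generically_side => // h e; apply: (m 0 h);
    first by rewrite lexx ler01.
  by rewrite subr0 scale1r scale0r addr0.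
apply: generically_imp (generically_and (generically_and (g _ _ r0) (g _ _ r1))
  (generically_and (g _ _ r2) (g _ _ r3))).
by move=> u [[? ?] [? ?]]; split.
Qed.

Lemma generically_all2 (R : realType) (T U : eqType) (S : seq T) (S' : seq U)
    (P : T -> U -> 'rV[R]_3 -> Prop) :
  (forall s s', s \in S -> s' \in S' -> generically (P s s')) ->
  generically (fun v => forall s s', s \in S -> s' \in S' -> P s s' v).
Proof.
move=> H.
have := generically_all (fun s sS => generically_all
  (fun s' s'S' => H s s' sS s'S')).
by apply: generically_imp => v h s s' sS s'S'; apply: h.
Qed.

(** Both directions are compared with a third one which is generic with respect to
    each of them; for closed polygons all boundary terms cancel. *)
Lemma sum_signed_crossing_indep (R : realType) S S' (x z v w : 'rV[R]_3) :
  polyline S x x -> polyline S' z z ->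
  (forall s s', s \in S -> s' \in S' -> apart s s') ->
  v != 0 -> (forall s s', s \in S -> s' \in S' -> patch_regular v s s') ->
  w != 0 -> (forall s s', s \in S -> s' \in S' -> patch_regular w s s') ->
  \sum_(s <- S) \sum_(s' <- S') signed_crossing v s s' =
  \sum_(s <- S) \sum_(s' <- S') signed_crossing w s s'.
Proof.
move=> aS aS' ap v0 rv w0 rw.
have gu := generically_all2 (fun s s' h h' =>
  generically_patch_regular (ap s s' h h')).
have gv := generically_all2 (fun s s' h h' =>
  generically_patch_generic v0 (rv s s' h h')).
have gw := generically_all2 (fun s s' h h' =>
  generically_patch_generic w0 (rw s s' h h')).
have [u [ru [uv uw]]] := generically_ex
  (generically_and gu (generically_and gv gw)).
suff key t : (forall s s', s \in S -> s' \in S' -> patch_regular t s s') ->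
    (forall s s', s \in S -> s' \in S' -> patch_generic t u s s') ->
    \sum_(s <- S) \sum_(s' <- S') signed_crossing t s s' =
    \sum_(s <- S) \sum_(s' <- S') signed_crossing u s s'.
  by rewrite (key v) // (key w).
move=> rt gt.
apply/eqP; rewrite -subr_eq0.
rewrite -[_ == 0]/((4 == 0)%N || _) -mulrn_eq0; apply/eqP.
rewrite -sumrB -sumrMnl.
transitivity (- \sum_(s <- S) \sum_(s' <- S') patch_sum (turning_term t u) s s').
  rewrite -sumrN; apply: eq_big_seq => s sS.
  rewrite -sumrB -sumrMnl -sumrN; apply: eq_big_seq => s' s'S'.
  by apply: signed_crossing_patch; [apply: rt|apply: ru|apply: gt].
rewrite (patch_sum_arcs (@turning_term_anti _ t u) aS aS').
by rewrite !big1 ?addr0 ?oppr0 // => ? _; rewrite subrr.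
Qed.

(** * The polygons of a spatial embedding *)

(** The edges of the path through the points of A, continued to z. *)
Definition chain (T : Type) (A : seq T) (z : T) : seq (T * T) := zip A
  (rcons (behead A) z).

Lemma chain_cons (T : Type) (x z : T) (A : seq T) :
  chain (x :: A) z = (x, head z A) :: chain A z.
Proof. by case: A. Qed.

Lemma chain_cat (T : Type) (A B : seq T) (z : T) :
  chain (A ++ B) z = chain A (head z B) ++ chain B z.
Proof.
elim: A => [|x A IH]; first by [].
rewrite cat_cons !chain_cons IH; congr ((_, _) :: _).
by case: A {IH}.
Qed.

Lemma chain_map (T U : Type) (g : T -> U) (A : seq T) (z : T) :
  chain (map g A) (g z) = [seq (g p.1, g p.2) | p <- chain A z].
Proof.
by elim: A => [//|x A IH] /=; rewrite !chain_cons IH /=; case: A {IH}.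
Qed.

Lemma chain_belast (T : Type) (x : T) (A : seq T) :
  chain (belast x A) (last x A) = zip (belast x A) A.
Proof.
elim: A x => [//|a A IH] x /=; rewrite chain_cons IH.
by congr ((_, _) :: _); case: A {IH}.
Qed.

Lemma chain_rev (T : Type) (x : T) (A : seq T) :
  chain (rev A) x = rev (map (@flip T) (zip (belast x A) A)).
Proof.
elim: A x => [//|a A IH] x /=.
by rewrite !rev_cons -cats1 chain_cat IH -cats1.
Qed.

Lemma sum_chain (T : Type) (V : zmodType) (h : T -> V) (A : seq T) (z : T) :
  \sum_(s <- chain A z) (h s.2 - h s.1) = h z - h (head z A).
Proof.
elim: A => [|x A IH]; first by rewrite big_nil subrr.
by rewrite chain_cons big_cons IH /= addrC subrKA.
Qed.

Lemma polygon_edgesE (R : realType) (P : seq 'rV[R]_3) :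
  polygon_edges P = chain P (head 0 P).
Proof. by case: P => // x P; rewrite /polygon_edges /chain rot1_cons. Qed.

Lemma chain_next (T : eqType) (c : seq T) (x0 : T) :
  uniq c -> [seq (x, next c x) | x <- c] = chain c (head x0 c).
Proof.
case: c => // a c uc; rewrite /chain [behead _]/= [head _ _]/=.
have sz : size [seq (x, next (a :: c) x) | x <- a :: c] =
  size (zip (a :: c) (rcons c a)).
  by rewrite size_map size_zip size_rcons minnn.
apply: (@eq_from_nth _ (a, a)) => // i; rewrite size_map => ic.
rewrite (nth_map a) // nth_zip ?size_rcons //; congr (_, _).
rewrite next_nth mem_nth // index_uniq // nth_rcons.
move: ic; rewrite /= ltnS leq_eqVlt => /orP[/eqP->|-> //].
by rewrite ltnn eqxx nth_default.
Qed.

Lemma next_mod (T : eqType) (c : seq T) (x0 : T) (i : nat) :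
  uniq c -> (i < size c)%N -> next c (nth x0 c i) = nth x0 c (i.+1 %% size c).
Proof.
move=> uc ic; rewrite next_nth mem_nth // index_uniq //.
case: c uc ic => // a c uc; rewrite ltnS leq_eqVlt => /orP[/eqP->|ic].
  by rewrite nth_default // modnn.
by rewrite modn_small // (set_nth_default x0).
Qed.

Lemma next_neq (T : eqType) (c : seq T) (x : T) :
  uniq c -> (1 < size c)%N -> x \in c -> next c x != x.
Proof.
move=> uc c1 /(nthP x)[i ic <-].
rewrite next_mod // nth_uniq ?ltn_pmod ?(ltnW c1) //.
move: ic; rewrite leq_eqVlt => /orP[/eqP h|h].
  by rewrite h modnn; apply/eqP => e0; move: c1; rewrite -h -e0.
by rewrite modn_small // -[X in _ != X]addn0 -addn1 eqn_add2l.
Qed.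

Definition vertex (R : realType) (n : nat) (i : 'I_n) : 'rV[R]_n := delta_mx 0 i.

Lemma edge_point0 (R : realType) (n : nat) (i j : 'I_n) : edge_point i j 0 =
  vertex R i.
Proof. by rewrite /edge_point subr0 scale1r scale0r addr0. Qed.

Lemma edge_point1 (R : realType) (n : nat) (i j : 'I_n) : edge_point i j 1 =
  vertex R j.
Proof. by rewrite /edge_point subrr scale1r scale0r add0r. Qed.

Lemma edge_point_rev (R : realType) (n : nat) (i j : 'I_n) (t : R) :
  edge_point j i t = edge_point i j (1 - t).
Proof. by rewrite /edge_point opprB addrCA subrr addr0 addrC. Qed.

Definition arc_segments (R : realType) (n : nat) (f : spatial_embedding R n)
  (x y : 'I_n) :=
  chain (edge_arc f x y) (f (vertex R y)).

Lemma arc_segmentsE (R : realType) (n : nat) (f : spatial_embedding R n)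
  (x y : 'I_n) :
  (x < y)%N -> arc_segments f x y =
    [seq (f (edge_point x y p.1), f (edge_point x y p.2))
       | p <- zip (belast 0 (emb_subdiv f x y)) (emb_subdiv f x y)].
Proof.
move=> xy; rewrite /arc_segments /edge_arc xy -(edge_point1 R x y).
rewrite (chain_map (fun t => f (edge_point x y t))).
by have [_ /eqP e] := emb_partition f xy; rewrite -[X in chain _ X]e chain_belast.
Qed.

Lemma arc_segments_flip (R : realType) (n : nat) (f : spatial_embedding R n)
  (x y : 'I_n) :
  x != y -> perm_eq (arc_segments f y x) (map (@flip _) (arc_segments f x y)).
Proof.
have key (a b : 'I_n) : (a < b)%N ->
    arc_segments f b a = rev (map (@flip _) (arc_segments f a b)).
  move=> ab; rewrite (arc_segmentsE f ab) /arc_segments /edge_arc ltnNge ltnW //=.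
  rewrite -(edge_point0 R a b) (chain_map (fun t => f (edge_point a b t)))
    chain_rev.
  by rewrite map_rev -!map_comp.
have fK (T : Type) : involutive (@flip T) by case.
rewrite -(inj_eq val_inj) neq_ltn => /orP[/key ->|/key ->];
  first by rewrite perm_rev.
by rewrite map_rev (mapK (fK _)) perm_sym perm_rev.
Qed.

Lemma edge_arc_cons (R : realType) (n : nat) (f : spatial_embedding R n)
  (x y : 'I_n) :
  x != y -> exists A, edge_arc f x y = f (vertex R x) :: A.
Proof.
rewrite -(inj_eq val_inj) neq_ltn /edge_arc => /orP[xy|yx].
  rewrite xy -(edge_point0 R x y); have [_ /eqP] := emb_partition f xy.
  case: (emb_subdiv f x y) => /= [/eqP|t s _]; first by rewrite eq_sym oner_eq0.
  by eexists.
rewrite ltnNge ltnW //= -(edge_point1 R y x); have [_ /eqP] := emb_partition f yx.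
case/lastP: (emb_subdiv f y x) => [/= /eqP|s b]; first by rewrite eq_sym oner_eq0.
by rewrite last_rcons rev_rcons /= => ->; eexists.
Qed.

Lemma arc_segments_polyline (R : realType) (n : nat) (f : spatial_embedding R n)
  (x y : 'I_n) :
  x != y -> polyline (arc_segments f x y) (f (vertex R x)) (f (vertex R y)).
Proof. move=> xy h; rewrite /arc_segments sum_chain.
by have [A ->] := edge_arc_cons f xy. Qed.

Lemma arc_segments_point (R : realType) (n : nat) (f : spatial_embedding R n)
  (x y : 'I_n) s (t : R) :
  x != y -> s \in arc_segments f x y -> 0 <= t <= 1 ->
  exists2 r, 0 <= r <= 1 & segment_point s t = f (edge_point x y r).
Proof.
have key (a b : 'I_n) s0 (t0 : R) : (a < b)%N -> s0 \in arc_segments f a b ->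
  0 <= t0 <= 1 ->
    exists2 r, 0 <= r <= 1 & segment_point s0 t0 = f (edge_point a b r).
  move=> ab; rewrite arc_segmentsE // => /mapP[p pin ->] tI.
  have part := emb_partition f ab.
  set sd := emb_subdiv f a b in pin part.
  have sz : size (belast 0 sd) = size sd by rewrite size_belast.
  have [k kl pE] : exists2 k, (k < size sd)%N & p = (nth 0 (0 :: sd) k, nth 0 sd k).
    have /(nthP (0, 0)) [k] := pin; rewrite size_zip sz minnn => kl <-;
      exists k => //.
    by rewrite nth_zip // lastI nth_rcons sz kl.
  have A : 0 <= nth 0 (0 :: sd) k <= 1.
    have kl' : (k < (size sd).+1)%N by rewrite ltnW.
    by rewrite (set_nth_default 1) // (itv_partition_nth_ge kl' part)
      (itv_partition_nth_le kl' part).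
  have B : 0 <= nth 0 sd k <= 1.
    rewrite -[nth 0 sd k]/(nth 0 (0 :: sd) k.+1).
    rewrite (set_nth_default 1) //.
    by rewrite (@itv_partition_nth_ge _ _ _ _ _ k.+1 _ part)
      ?(@itv_partition_nth_le _ _ _ _ _ k.+1 _ part).
  exists ((1 - t0) * nth 0 (0 :: sd) k + t0 * nth 0 sd k); first by nra.
  by rewrite (emb_affine ab kl tI) pE.
move=> xy; have := xy; rewrite -(inj_eq val_inj) neq_ltn => /orP[lt|lt] sin tI;
  first exact: key.
have [s' s'in sE] : exists2 s', s' \in arc_segments f y x & s = flip s'.
  by move: sin; rewrite (perm_mem (arc_segments_flip f _)) 1?eq_sym // =>
    /mapP[s' ? ?]; exists s'.
have [|r rI rE] := key y x s' (1 - t) lt s'in; first by lra.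
exists (1 - r); first by lra.
by rewrite sE segment_point_flip rE edge_point_rev.
Qed.

Lemma arc_segments_apart (R : realType) (n : nat) (f : spatial_embedding R n)
  (x y z w : 'I_n) s s' :
  uniq [:: x; y; z; w] -> s \in arc_segments f x y -> s' \in arc_segments f z w ->
    apart s s'.
Proof.
rewrite /= !inE !negb_or !andbT => /and3P[/and3P[xy xz xw] /andP[yz yw] zw] sin s'in
  t t' tI t'I.
have [r rI ->] := arc_segments_point xy sin tI.
have [r' r'I ->] := arc_segments_point zw s'in t'I.
have K (a b : 'I_n) (q : R) : a != b -> 0 <= q <= 1 ->
  edge_point a b q \in (@complete_graph_space R n).
  by move=> ab qI; apply/mem_set; exists a, b, q.
move/(emb_inj (K _ _ _ xy rI) (K _ _ _ zw r'I)) => e.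
have := congr1 (fun u : 'rV_n => u 0 x) e;
  have := congr1 (fun u : 'rV_n => u 0 y) e.
rewrite /edge_point !mxE !eqxx (negbTE xy) (negbTE xz) (negbTE xw) (negbTE yz)
  (negbTE yw) eq_sym (negbTE xy).
move=> /= h1 h2; lra.
Qed.

Lemma flatten_arcs (R : realType) (n : nat) (f : spatial_embedding R n) (x z : 'I_n)
  (s : seq 'I_n) :
  all (fun p => p.1 != p.2) (chain (x :: s) z) ->
  (exists A, flatten [seq edge_arc f p.1 p.2 | p <- chain (x :: s) z] =
    f (vertex R x) :: A) /\
  chain (flatten [seq edge_arc f p.1 p.2 | p <- chain (x :: s) z])
    (f (vertex R z)) =
    flatten [seq arc_segments f p.1 p.2 | p <- chain (x :: s) z].
Proof.
elim: s x => [|y s IH] x; rewrite chain_cons /= => /andP[xy].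
  have [A E] := edge_arc_cons f xy.
  by move=> _; rewrite !cats0; split=> //; exists A.
move=> /IH [[B EB] E]; rewrite chain_cat E EB; split=> //.
by have [A EA] := edge_arc_cons f xy; exists (A ++ f (vertex R y) :: B); rewrite EA.
Qed.

Lemma cycle_polygon_edges (R : realType) (n : nat) (f : spatial_embedding R n)
  (c : seq 'I_n) :
  uniq c -> (1 < size c)%N ->
  polygon_edges (cycle_polygon f c) = flatten
    [seq arc_segments f x (next c x) | x <- c].
Proof.
move=> uc sc; have [x0 [s cE]] : exists x0 s, c =
  x0 :: s by case: c sc {uc} => // x s; exists x, s.
have chE : [seq (x, next c x) | x <- c] = chain (x0 :: s) x0.
  by rewrite (chain_next x0 uc) cE.
have mE (T : Type) (g : 'I_n -> 'I_n -> T) :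
    [seq g x (next c x) | x <- c] = [seq g p.1 p.2 | p <- chain (x0 :: s) x0].
  by rewrite -chE -map_comp.
have neq : all (fun p => p.1 != p.2) (chain (x0 :: s) x0).
  by rewrite -chE all_map; apply/allP => x xc /=; rewrite eq_sym next_neq.
have [[A EA] E] := flatten_arcs f neq.
by rewrite polygon_edgesE /cycle_polygon !mE -E EA.
Qed.

(** As a regular direction exists, the one chosen in the definition is regular. *)
Lemma linking_numberE (R : realType) (P Q : seq 'rV[R]_3) (x z v : 'rV[R]_3) :
  polyline (polygon_edges P) x x -> polyline (polygon_edges Q) z z ->
  (forall s s', s \in polygon_edges P -> s' \in polygon_edges Q -> apart s s') ->
  v != 0 ->
  (forall s s', s \in polygon_edges P -> s' \in polygon_edges Q ->
    patch_regular v s s') ->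
  linking_number P Q =
  (\sum_(s <- polygon_edges P) \sum_(s' <- polygon_edges Q) signed_crossing v s
    s')%:~R / 2.
Proof.
move=> pP pQ ap v0 rv.
have missE (w : 'rV[R]_3) s s' :
    [/\ misses w (corner0 s s') (corner1 s s') <-> ~ shadows_meet w s (s'.1, s'.1),
      misses w (corner1 s s') (corner2 s s') <-> ~ shadows_meet w (s.2, s.2) s',
      misses w (corner2 s s') (corner3 s s') <-> ~ shadows_meet w s (s'.2, s'.2) &
      misses w (corner3 s s') (corner0 s s') <-> ~ shadows_meet w (s.1, s.1) s'].
  split; split=> [m [t [t' [h [tI t'I E]]]]|m t h tI E].
  - by apply: (m t h tI); rewrite -E; apply: rV3P; rewrite !mxE /=; ring.
  - apply: m; exists t, 0, h; split=> //; first by rewrite lexx ler01.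
    by rewrite -E; apply: rV3P; rewrite !mxE /=; ring.
  - by apply: (m t' h t'I); rewrite -E; apply: rV3P; rewrite !mxE /=; ring.
  - apply: m; exists 0, t, h; split=> //; first by rewrite lexx ler01.
    by rewrite -E; apply: rV3P; rewrite !mxE /=; ring.
  - apply: (m (1 - t) h); first by lra.
    by rewrite -E; apply: rV3P; rewrite !mxE /=; ring.
  - apply: m; exists (1 - t), 0, h; split; [by lra|by rewrite lexx ler01|].
    by rewrite -E; apply: rV3P; rewrite !mxE /=; ring.
  - apply: (m (1 - t') h); first by lra.
    by rewrite -E; apply: rV3P; rewrite !mxE /=; ring.
  - apply: m; exists 0, (1 - t), h; split; [by rewrite lexx ler01|by lra|].
    by rewrite -E; apply: rV3P; rewrite !mxE /=; ring.
have regE w : regular_direction P Q w <->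
    w != 0 /\ (forall s s', s \in polygon_edges P -> s' \in polygon_edges Q ->
      patch_regular w s s').
  have sndP (S : seq 'rV[R]_3) s : s \in polygon_edges S ->
      exists2 s1, s1 \in polygon_edges S & s1.1 = s.2.
    rewrite /polygon_edges => h.
    have : s.2 \in unzip1 (zip S (rot 1 S)).
      rewrite unzip1_zip ?size_rot // -(mem_rot 1)
        -[X in _ \in X](@unzip2_zip _ _ S (rot 1 S)) ?size_rot //.
      exact: map_f.
    by case/mapP => s1 ? ->; exists s1.
  split=> [[w0 H]|[w0 H]]; split=> // s s' sP s'Q.
    have [s1 s1P E1] := sndP _ _ sP; have [s1' s1Q E1'] := sndP _ _ s'Q.
    have [m0 m1 m2 m3] := missE w s s'.
    have [h3 h0] := H s s' sP s'Q; have [h1 _] := H s1 s' s1P s'Q;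
      have [_ h2] := H s s1' sP s1Q.
    by rewrite E1 in h1; rewrite E1' in h2; split;
      [apply/m0|apply/m1|apply/m2|apply/m3].
  have [m0 m1 m2 m3] := missE w s s'; have [/m0 ? _ _ /m3 ?] := H s s' sP s'Q.
  by split.
rewrite /linking_number; set w := xget _ _.
have [w0 rw] : w != 0 /\ (forall s s', s \in polygon_edges P ->
  s' \in polygon_edges Q -> patch_regular w s s').
  by apply/regE; rewrite /w; apply: (@xgetPex _ 0
    [set v | regular_direction P Q v]%classic); exists v; apply/regE.
rewrite (sum_signed_crossing_indep pP pQ ap v0 rv w0 rw); congr (_%:~R / 2).
by apply: eq_bigr => s _; rewrite big_mkcond.
Qed.

(** * Crossings of two disjoint edges *)

(** The last condition makes the linear form side v u injective on the images of the
    vertices, so that it orders them. *)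
Definition good_directions (R : realType) (n : nat) (f : spatial_embedding R n)
    (v u : 'rV[R]_3) : Prop :=
  [/\ v != 0,
    forall x y z w s s', uniq [:: x; y; z; w] ->
      s \in arc_segments f x y -> s' \in arc_segments f z w ->
      patch_regular v s s' /\ patch_generic v u s s' &
    forall x y, x != y -> side v u (f (vertex R y) - f (vertex R x)) != 0].

Lemma vertex_image_neq (R : realType) (n : nat) (f : spatial_embedding R n)
  (x y : 'I_n) :
  x != y -> f (vertex R y) - f (vertex R x) != 0.
Proof.
move=> xy; rewrite subr_eq0; apply/eqP => e.
have K (a b : 'I_n) : a != b -> vertex R a \in (@complete_graph_space R n).
  by move=> ab; apply/mem_set; exists a, b, 0; rewrite edge_point0 lexx ler01.
have yx : y != x by rewrite eq_sym.
have := emb_inj (K _ _ yx) (K _ _ xy) e.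
move/(congr1 (fun M : 'rV_n => M 0 x)); rewrite !mxE !eqxx (negbTE xy) => /eqP.
by rewrite eq_sym oner_eq0.
Qed.

Lemma good_directions_ex (R : realType) (n : nat) (f : spatial_embedding R n) :
  exists v u, good_directions f v u.
Proof.
pose quads := [seq q <- enum {: 'I_n * 'I_n * ('I_n * 'I_n)} | uniq
  [:: q.1.1; q.1.2; q.2.1; q.2.2]].
pose pairs := [seq q <- enum {: 'I_n * 'I_n} | q.1 != q.2].
have g1 : generically (fun v => forall q, q \in quads ->
    forall s s', s \in arc_segments f q.1.1 q.1.2 ->
      s' \in arc_segments f q.2.1 q.2.2 ->
      patch_regular v s s').
  apply: generically_all => q; rewrite mem_filter => /andP[uq _].
  apply: generically_all2 => s s' sin s'in; apply: generically_patch_regular.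
  exact: arc_segments_apart uq sin s'in.
have g2 : generically (fun v => forall q, q \in pairs ->
    misses v (f (vertex R q.2) - f (vertex R q.1))
      (f (vertex R q.2) - f (vertex R q.1))).
  apply: generically_all => q; rewrite mem_filter => /andP[xy _].
  apply: generically_misses => t _; rewrite -scalerDl subrK scale1r.
  exact/eqP/vertex_image_neq.
have [v [v0 [rv mv]]] := generically_ex
  (generically_and (generically_nonzero R) (generically_and g1 g2)).
have h1 : generically (fun u => forall q, q \in quads ->
    forall s s', s \in arc_segments f q.1.1 q.1.2 ->
      s' \in arc_segments f q.2.1 q.2.2 ->
      patch_generic v u s s').
  apply: generically_all => q qin.
  by apply: generically_all2 => s s' sin s'in;
    apply: generically_patch_generic => //; apply: rv qin _ _ _ _.
have h2 : generically (fun u => forall q, q \in pairs ->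
    side v u (f (vertex R q.2) - f (vertex R q.1)) != 0).
  apply: generically_all => q qin; apply: generically_side => // h e.
  apply: (mv _ qin 0 h); first by rewrite lexx ler01.
  by rewrite -scalerDl subrK scale1r.
have [u [gu su]] := generically_ex (generically_and h1 h2).
exists v, u; split=> // [x y z w s s' uq sin s'in|x y xy].
  have qin : (x, y, (z, w)) \in quads by rewrite mem_filter uq mem_enum.
  by split; [apply: (rv _ qin)|apply: (gu _ qin)].
by apply: (su (x, y)); rewrite mem_filter xy mem_enum.
Qed.

(** The guard makes the antisymmetry under reversal of an edge unconditional. *)
Definition sum_arcs (R : realType) (n : nat) (f : spatial_embedding R n)
    (k : 'rV[R]_3 * 'rV[R]_3 -> 'rV[R]_3 * 'rV[R]_3 -> int) (x y z w : 'I_n) :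
      int :=
  if uniq [:: x; y; z; w] then
    \sum_(s <- arc_segments f x y) \sum_(s' <- arc_segments f z w) k s s' else 0.

Lemma uniq4_swap (T : eqType) (x y z w : T) : uniq [:: y; x; z; w] =
  uniq [:: x; y; z; w].
Proof. by rewrite /= !inE [y == x]eq_sym; do ![case: (_ == _)]. Qed.

Lemma uniq4_sym (T : eqType) (x y z w : T) : uniq [:: z; w; x; y] =
  uniq [:: x; y; z; w].
Proof.
rewrite /= !inE [z == x]eq_sym [z == y]eq_sym [w == x]eq_sym [w == y]eq_sym.
by do ![case: (_ == _)].
Qed.

Lemma sum_arcs_flip (R : realType) (n : nat) (f : spatial_embedding R n) k
  (x y z w : 'I_n) :
  (forall s s', k (flip s) s' = - k s s') ->
  sum_arcs f k y x z w = - sum_arcs f k x y z w.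
Proof.
move=> kflip; rewrite /sum_arcs uniq4_swap; case: ifP => uq; last by rewrite oppr0.
have xy : x != y by move: uq; rewrite /= !inE !negb_or => /andP[/andP[]].
rewrite (perm_big _ (arc_segments_flip f xy)) /= big_map -sumrN.
by apply: eq_bigr => s _; rewrite -sumrN; apply: eq_bigr => s' _.
Qed.

Lemma sum_arcs_sym (R : realType) (n : nat) (f : spatial_embedding R n) k
  k' (x y z w : 'I_n) :
  (forall s s', k s' s = k' s s') -> sum_arcs f k z w x y = sum_arcs f k' x y z w.
Proof.
move=> kk'; rewrite /sum_arcs uniq4_sym; case: ifP => // uq.
by rewrite exchange_big; apply: eq_bigr => s _; apply: eq_bigr => s' _.
Qed.

(** Intersection of the edge yy' with one of the two halves into which the line
    spanned by v divides the plane of v and u; planar_term counts the intersections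
    with both halves, with opposite signs. *)
Definition upper_crossing (R : realType) (v u y y' : 'rV[R]_3) : int :=
  side_term (side v u y) (side v u y')
    (if sgz (det3 y y' v) == sgz (side v u y') then sgz (side v u y') else 0).

Lemma upper_crossingE (R : realType) (v u y y' : 'rV[R]_3) :
  side v u y != 0 -> side v u y' != 0 ->
  transverse (side v u y) (side v u y') (det3 y y' v) ->
  planar_term v u y y' *+ 2 + (sgz (side v u y') - sgz (side v u y)) =
    upper_crossing v u y y' *+ 4.
Proof.
rewrite /planar_term /upper_crossing /side_term /transverse.
case: (sgzP (side v u y)) => // _ _; case: (sgzP (side v u y')) => // _ _ /=;
  rewrite ?subrr ?mul0rn // => /(_ isT); by case: sgzP.
Qed.

Definition arc_planar_term (R : realType) (n : nat) (f : spatial_embedding R n) v u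
  (x y z : 'I_n) : int :=
  \sum_(s <- arc_segments f x y) planar_term v u (f (vertex R z) - s.1)
    (f (vertex R z) - s.2).

Definition arc_upper (R : realType) (n : nat) (f : spatial_embedding R n) v u
  (x y z : 'I_n) : int :=
  \sum_(s <- arc_segments f x y) upper_crossing v u (f (vertex R z) - s.1)
    (f (vertex R z) - s.2).

Definition vertex_sign (R : realType) (n : nat) (f : spatial_embedding R n) v u
  (x y : 'I_n) : int :=
  sgz (side v u (f (vertex R y) - f (vertex R x))).

(** The intersections of an arc with both halves of the plane add up to its
    intersection with the whole plane, which only depends on the sides of its ends. *)
Lemma arc_upperE (R : realType) (n : nat) (f : spatial_embedding R n) v u
  (x y z w : 'I_n) :
  good_directions f v u -> uniq [:: x; y; z; w] ->
  2 * arc_planar_term f v u x y z + (vertex_sign f v u y z - vertex_sign f v u x z)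
    =
  4 * arc_upper f v u x y z.
Proof.
move=> [_ good _] uq.
have [xy zw] : x != y /\ z != w.
  by move: uq; rewrite /= !inE !negb_or !andbT => /and3P[/and3P[? _ _] _ ?].
rewrite !mulr_natl /vertex_sign -(arc_segments_polyline f xy
  (fun p => sgz (side v u (f (vertex R z) - p)))).
rewrite /arc_planar_term /arc_upper -!sumrMnl -big_split;
  apply: eq_big_seq => s sin /=.
have [s' s'in E] : exists2 s', s' \in arc_segments f z w & s'.1 = f (vertex R z).
  rewrite /arc_segments; have [A ->] := edge_arc_cons f zw.
  by rewrite chain_cons; eexists; [exact: mem_head|].
have [[r0 _ _ _] [g0 g1 _ _]] := good _ _ _ _ _ _ uq sin s'in.
rewrite /corner0 /corner1 E in r0 g0 g1.
by apply: upper_crossingE => //; apply: misses_transverse.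
Qed.

Lemma planar_crossing_arcs (R : realType) (n : nat) (f : spatial_embedding R n) v u
  (x y z w : 'I_n) :
  good_directions f v u -> uniq [:: x; y; z; w] ->
  2 * sum_arcs f (planar_crossing v) x y z w =
  arc_planar_term f v u x y z - arc_planar_term f v u x y w +
    arc_planar_term f v u z w y - arc_planar_term f v u z w x.
Proof.
move=> [_ good _] uq.
have [xy zw] : x != y /\ z != w.
  by move: uq; rewrite /= !inE !negb_or !andbT => /and3P[/and3P[? _ _] _ ?].
rewrite mulr_natl /sum_arcs uq -sumrMnl.
transitivity (\sum_(s <- arc_segments f x y) \sum_(s' <- arc_segments f z w)
  patch_sum (planar_term v u) s s').
  apply: eq_big_seq => s sin; rewrite -sumrMnl; apply: eq_big_seq => s' s'in.
  by have [? ?] := good _ _ _ _ _ _ uq sin s'in; apply: planar_crossing_patch.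
rewrite (patch_sum_arcs (@planar_term_anti _ v u) (arc_segments_polyline f xy)
  (arc_segments_polyline f zw)).
rewrite !sumrB addrA; congr (_ + _ - _).
all: by apply: eq_bigr => s _; rewrite -planar_term_opp !opprB.
Qed.

(** Equal to (vertex_sign - 1) / 2; the value 0 means that x comes before y. *)
Definition precedes (R : realType) (n : nat) (f : spatial_embedding R n) v u
  (x y : 'I_n) : int :=
  if 0 < side v u (f (vertex R y) - f (vertex R x)) then 0 else -1.

Lemma vertex_signE (R : realType) (n : nat) (f : spatial_embedding R n) v u
  (x y : 'I_n) :
  good_directions f v u -> x != y -> vertex_sign f v u x y =
    2 * precedes f v u x y + 1.
Proof.
move=> [_ _ good] xy; rewrite /vertex_sign /precedes.
by have := good x y xy; case: (sgzP (side _ _ _)).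
Qed.

Lemma vertex_sign_sym (R : realType) (n : nat) (f : spatial_embedding R n) v u
  (x y : 'I_n) :
  vertex_sign f v u y x = - vertex_sign f v u x y.
Proof. by rewrite /vertex_sign -sgzN; congr sgz; coords; ring. Qed.

Lemma precedes_sym (R : realType) (n : nat) (f : spatial_embedding R n) v u
  (x y : 'I_n) :
  good_directions f v u -> x != y -> precedes f v u y x = - 1 - precedes f v u x y.
Proof.
move=> good xy; have := vertex_sign_sym f v u x y.
have yx : y != x by rewrite eq_sym.
by rewrite (vertex_signE good xy) (vertex_signE good yx); lia.
Qed.

Lemma planar_crossing_decomposition (R : realType) (n : nat)
  (f : spatial_embedding R n) v u (x y z w : 'I_n) :
  good_directions f v u -> uniq [:: x; y; z; w] ->
  sum_arcs f (planar_crossing v) x y z w =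
  arc_upper f v u x y z - arc_upper f v u x y w +
    arc_upper f v u z w y - arc_upper f v u z w x
  - (precedes f v u y z - precedes f v u x z - precedes f v u y w +
      precedes f v u x w).
Proof.
move=> good uq; have := planar_crossing_arcs good uq.
have uq1 : uniq [:: x; y; w; z] by move: uq;
  rewrite -uniq4_sym uniq4_swap uniq4_sym.
have uq2 : uniq [:: z; w; x; y] by rewrite uniq4_sym.
have uq3 : uniq [:: z; w; y; x] by rewrite uniq4_sym uniq4_swap.
have := arc_upperE good uq; have := arc_upperE good uq1.
have := arc_upperE good uq2; have := arc_upperE good uq3.
move: uq; rewrite /= !inE !negb_or !andbT =>
  /and3P[/and3P[xy xz xw] /andP[yz yw] zw].
rewrite (vertex_sign_sym f v u x z) (vertex_sign_sym f v u y z)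
  (vertex_sign_sym f v u x w) (vertex_sign_sym f v u y w).
by rewrite !(vertex_signE good) //; lia.
Qed.

(** * Six vertices *)

Definition triangles (V : Type) (O : V -> V -> V -> V -> int) (p q r s t u : V) :
  int :=
  (O p q s t + O p q t u + O p q u s) + (O q r s t + O q r t u + O q r u s)
  + (O r p s t + O r p t u + O r p u s).

Arguments triangles : simpl never.

(** Each pair of a triangle with its complement is listed with the triangle through a
    first.  A pair of disjoint edges ax, zw thus contributes O a x z w to two of the
    ten sums.  A pair xy, zw avoiding a occurs once in each order, and so contributes,
    modulo 2, the difference of O x y z w and O z w x y.  In the sum of these fifteen
    differences every U occurs twice, and the terms in o add up to an odd number. *)
Lemma sum_triangles_neq0 (V : eqType) (O : V -> V -> V -> V -> int)
  (U : V -> V -> V -> int)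
    (o : V -> V -> int) (a b c d e g : V) :
  (forall x y z w, O x y z w = - O y x z w) ->
  (forall x y z w, O x y z w = - O x y w z) ->
  (forall x y z w, uniq [:: x; y; z; w] -> O z w x y = O x y z w
     - (U x y z - U x y w + U z w y - U z w x - (o y z - o x z - o y w + o x w))) ->
  (forall x y, x != y -> o y x = - 1 - o x y) ->
  uniq [:: a; b; c; d; e; g] ->
  (triangles O a b c d e g + triangles O a e g d b c + triangles O d a g e b c +
    triangles O d e a g b c + triangles O a d c b e g + triangles O a e c d b g +
    triangles O a g c d e b + triangles O a b d c e g + triangles O a b e d c g +
    triangles O a b g d e c <> 0).
Proof.
move=> f1 f2 sw0 os uq.
move: uq; rewrite /= !inE !negb_or !andbT =>
  /and5P[/and5P[ab ac ad ae ag] /and4P[bc bd be bg] /and3P[cd ce cg] /andP[de dg]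
  eg].
rewrite /triangles.
rewrite !(f1 b a, f1 c a, f1 d a, f1 e a, f1 g a, f1 c b, f1 d b, f1 e b, f1 g b,
  f1 d c, f1 e c, f1 g c, f1 e d, f1 g d, f1 g e).
rewrite !(f2 _ _ b a, f2 _ _ c a, f2 _ _ d a, f2 _ _ e a, f2 _ _ g a, f2 _ _ c b,
  f2 _ _ d b, f2 _ _ e b, f2 _ _ g b, f2 _ _ d c, f2 _ _ e c, f2 _ _ g c,
  f2 _ _ e d, f2 _ _ g d, f2 _ _ g e).
have ne (x y : V) : x != y -> y != x by rewrite eq_sym.
have sw x y z w : x != y -> x != z -> x != w -> y != z -> y != w -> z != w ->
    O z w x y = O x y z w
     - (U x y z - U x y w + U z w y - U z w x - (o y z - o x z - o y w + o x w)).
  by move=> xy xz xw yz yw zw; apply: sw0;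
    rewrite /= !inE !negb_or xy xz xw yz yw zw.
have [dc ec gc] := And3 (ne _ _ cd) (ne _ _ ce) (ne _ _ cg).
have [ed gd ge] := And3 (ne _ _ de) (ne _ _ dg) (ne _ _ eg).
rewrite !(sw b c d e, sw b d c e, sw b e c d, sw b c d g, sw b d c g, sw b g c d,
  sw b c e g, sw b e c g, sw b g c e, sw b d e g, sw b e d g, sw b g d e,
  sw c d e g, sw c e d g, sw c g d e) //.
rewrite !(os b c, os b d, os b e, os b g, os c d, os c e, os c g, os d e, os d g,
  os e g) //.
(* modulo 2, only the constant term is left *)
clear; lia.
Qed.

(** * Averages over permutations of the vertices *)

Lemma next2_neq (T : eqType) (c : seq T) (x : T) :
  uniq c -> (2 < size c)%N -> x \in c -> next c (next c x) != x.
Proof.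
move=> uc c2 /(nthP x)[i ic <-].
have c0 : (0 < size c)%N by exact: leq_trans c2.
rewrite next_mod // next_mod ?ltn_pmod // nth_uniq ?ltn_pmod //.
rewrite -addn1 modnDml addn1.
have [h|h] := ltnP i.+2 (size c).
  by rewrite modn_small // -[X in _ != X]addn0 -addn2 eqn_add2l.
rewrite -(subnK h) modnDr modn_small; last by lia.
by apply/eqP; lia.
Qed.

Lemma sum_next (T : eqType) (V : nmodType) (c : seq T) (h : T -> V) :
  uniq c -> \sum_(x <- c) h (next c x) = \sum_(x <- c) h x.
Proof.
case: c => [|x0 c] uc; first by rewrite !big_nil.
transitivity (\sum_(p <- [seq (x, next (x0 :: c) x) | x <- x0 :: c]) h p.2).
  by rewrite big_map.
rewrite (chain_next x0 uc) /chain -(big_map snd xpredT) -/(unzip2 _) unzip2_zip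
  ?size_rcons //.
by rewrite /= -cats1 big_cat big_seq1 [RHS]big_cons addrC.
Qed.

Definition cycle_sum (V : eqType) (O : V -> V -> V -> V -> int) (c c' : seq V) :
  int :=
  \sum_(x <- c) \sum_(z <- c') O x (next c x) z (next c' z).

Lemma cycle_sum_map (V : eqType) (O : V -> V -> V -> V -> int) (g : V -> V)
  (c c' : seq V) :
  injective g -> uniq c -> uniq c' ->
  cycle_sum O (map g c) (map g c') =
  \sum_(x <- c) \sum_(z <- c') O (g x) (g (next c x)) (g z) (g (next c' z)).
Proof.
move=> gI uc uc'; rewrite /cycle_sum big_map; apply: eq_bigr => x _.
by rewrite big_map; apply: eq_bigr => z _; rewrite !next_map.
Qed.

Lemma cycle_sum_triangles (V : eqType) (O : V -> V -> V -> V -> int)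
  (p q r s t u : V) :
  uniq [:: p; q; r] -> uniq [:: s; t; u] ->
  cycle_sum O [:: p; q; r] [:: s; t; u] = triangles O p q r s t u.
Proof.
move=> u1 u2; rewrite /cycle_sum.
transitivity (\sum_(i <- [seq (x, next [:: p; q; r] x) | x <- [:: p; q; r]])
  \sum_(j <- [seq (x, next [:: s; t; u] x) | x <- [:: s; t; u]]) O i.1 i.2 j.1 j.2).
  by rewrite big_map; apply: eq_bigr => x _; rewrite big_map.
rewrite (chain_next p u1) (chain_next s u2) /chain /= !big_cons !big_nil /triangles.
by rewrite !addr0 !addrA.
Qed.

(** Any list of distinct elements of B can be moved to any other one of the same
    length by transpositions of elements of B. *)
Lemma tperm_transitive (T : finType) (W : Type) (B : pred T) (H : seq T -> W)
  (l l' : seq T) :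
  (forall u w, B u -> B w -> forall k, H (map (tperm u w) k) = H k) ->
  size l = size l' -> all B l -> all B l' -> uniq l -> uniq l' -> H l = H l'.
Proof.
move=> inv sz Bl Bl' ul ul'.
suff [t [tl tH _]] : exists t : {perm T}, [/\ map t l = l',
    forall k, H (map t k) = H k & forall x, B x -> B (t x)] by rewrite -tl tH.
elim: l l' sz Bl Bl' ul ul' => [|x l IH] [|y l'] //=.
  by exists 1%g; split=> // [k|x]; rewrite ?perm1 // (eq_map (@perm1 T)) map_id.
case=> sz /andP[Bx Bl] /andP[By Bl'] /andP[xl ul] /andP[yl' ul'].
have [t [tl tH tB]] := IH l' sz Bl Bl' ul ul'.
have txl' : t x \notin l' by rewrite -tl mem_map //; exact: perm_inj.
exists (t * tperm (t x) y)%g; split=> [|k|z Bz].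
- rewrite permM tpermL; congr (_ :: _); rewrite -[RHS]tl; apply/eq_in_map => z zl.
  have tz : t z \in l' by rewrite -tl map_f.
  by rewrite permM tpermD //; [apply: contraNneq txl' | apply: contraNneq yl'] =>
    ->.
- rewrite (eq_map (permM _ _)) (map_comp (tperm (t x) y) t) inv ?tH //; exact: tB.
- by rewrite permM; case: tpermP => *; first [exact: By | exact: tB].
Qed.

(** Expand the square.  For two disjoint edges of the cycle the sum over s of the
    product vanishes, since composing s with the transposition of the ends of one
    edge changes its sign.  For an edge with itself, and for two adjacent edges, the
    sum does not depend on the position of the edges.  Each edge has two adjacent
    ones, so the total is a constant times the length of the cycle. *)
Lemma sum_sqr_cycle (T : finType) (B : pred T) (phi : {perm T} -> T -> T -> int)
    (c t : seq T) :
  (forall s a b, phi s b a = - phi s a b) ->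
  (forall u w s a b, B u -> B w ->
     phi (tperm u w * s)%g a b = phi s (tperm u w a) (tperm u w b)) ->
  uniq c -> all B c -> (2 < size c)%N -> uniq t -> all B t -> size t = 3 ->
  3 * \sum_(s : {perm T}) (\sum_(x <- c) phi s x (next c x)) ^+ 2 =
  (size c)%:R * \sum_(s : {perm T}) (\sum_(x <- t) phi s x (next t x)) ^+ 2.
Proof.
move=> anti equiv uc Bc sc ut Bt st.
pose G a b a' b' := \sum_(s : {perm T}) phi s a b * phi s a' b'.
have Ginv u w : B u -> B w -> forall a b a' b',
    G (tperm u w a) (tperm u w b) (tperm u w a') (tperm u w b') = G a b a' b'.
  move=> Bu Bw a b a' b'; rewrite /G [RHS](reindex_inj (mulgI (tperm u w))).
  by apply: eq_bigr => s _; rewrite !equiv.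
have Gsym a b a' b' : G a b a' b' = G a' b' a b.
  by apply: eq_bigr => s _; rewrite mulrC.
have Ganti a b a' b' : G b a a' b' = - G a b a' b'.
  by rewrite /G -sumrN; apply: eq_bigr => s _; rewrite anti mulNr.
have [x [y [z tE]]] : exists x y z, t = [:: x; y; z].
  by case: t st {ut Bt} => // x [|y [|z [|]]] // _; exists x, y, z.
have key d : uniq d -> all B d -> (2 < size d)%N ->
    \sum_(s : {perm T}) (\sum_(i <- d) phi s i (next d i)) ^+ 2 =
    (size d)%:R * (G x y x y + 2 * G x y y z).
  move=> ud /allP Bd sd.
  transitivity (\sum_(i <- d) \sum_(j <- d) G i (next d i) j (next d j)).
    under eq_bigr do rewrite expr2 mulr_suml.
    rewrite exchange_big; apply: eq_bigr => i _.
    under eq_bigr do rewrite mulr_sumr.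
    by rewrite exchange_big.
  rewrite -sum1_size natr_sum mulr_suml; apply: eq_big_seq => i id.
  rewrite mul1r.
  have nd : next d i \in d by rewrite mem_next.
  have pd : prev d i \in d by rewrite mem_prev.
  have npE : next d (prev d i) = i by rewrite next_prev.
  have ni : next d i != i by rewrite next_neq // ltnW.
  have pi : prev d i != i by rewrite -{2}npE eq_sym next_neq // ltnW.
  have pn : prev d i != next d i.
    by apply/eqP => e; have := next2_neq ud sd id; rewrite -e npE eqxx.
  have mem1 j : j \in rem i d = (j != i) && (j \in d) by rewrite mem_rem_uniq.
  have mem2 j : j \in rem (next d i) (rem i d) =
    [&& j != next d i, j != i & j \in d].
    by rewrite mem_rem_uniq ?rem_uniq // inE mem1.
  have mem3 j : j \in rem (prev d i) (rem (next d i) (rem i d)) =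
      [&& j != prev d i, j != next d i, j != i & j \in d].
    by rewrite mem_rem_uniq ?rem_uniq // inE mem2.
  rewrite (big_rem i) //= (big_rem (next d i)) ?mem1 ?ni //=.
  rewrite (big_rem (prev d i)) ?mem2 ?pn ?pi //= big_seq big1 ?addr0; last first.
    move=> j; rewrite mem3 => /and4P[jp jn ji jd].
    have nji : next d j != i by apply: contra jp => /eqP <-; rewrite prev_next.
    have njn : next d j != next d i.
      by apply: contra ji => /eqP e; rewrite -(prev_next ud j) e prev_next.
    have := Ginv _ _ (Bd _ id) (Bd _ nd) i (next d i) j (next d j).
    have jE k : k != i -> k != next d i -> tperm i (next d i) k = k.
      by move=> ki kn; rewrite tpermD // eq_sym.
    rewrite tpermL tpermR (jE j) // (jE (next d j)) // Ganti => /eqP.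
    by rewrite -subr_eq0 -opprD oppr_eq0 -mulr2n mulrn_eq0 => /eqP.
  rewrite npE (Gsym _ _ (prev d i)).
  have tr (H : T -> T -> T -> int) a b e :
      (forall u w, B u -> B w -> forall a b e,
        H (tperm u w a) (tperm u w b) (tperm u w e) = H a b e) ->
      a \in d -> b \in d -> e \in d -> uniq [:: a; b; e] -> H a b e = H x y z.
    move=> Hinv ad bd ed u3.
    pose HS (l : seq T) := if l is [:: a; b; e] then H a b e else 0.
    apply: (@tperm_transitive _ _ B HS [:: a; b; e] [:: x; y; z]) => //=.
    - by move=> u w Bu Bw [|? [|? [|? []]]] //=; exact: Hinv.
    - by rewrite !Bd.
    - by move: Bt; rewrite tE.
    - by move: ut; rewrite tE.
  have -> : G i (next d i) i (next d i) = G x y x y.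
    apply: (tr (fun a b _ => G a b a b) _ _ (prev d i)) => //.
      by move=> u w Bu Bw a b _; exact: Ginv.
    by rewrite /= !inE negb_or andbT eq_sym ni eq_sym pi eq_sym pn.
  have tr2 a b e : a \in d -> b \in d -> e \in d -> uniq [:: a; b; e] -> G a b b e =
    G x y y z.
    by apply: (tr (fun a b e => G a b b e)) => u w Bu Bw a' b' e'; exact: Ginv.
  have -> : G i (next d i) (next d i) (next d (next d i)) = G x y y z.
    apply: tr2; rewrite ?mem_next //= !inE negb_or andbT eq_sym ni eq_sym
      next2_neq //=.
    by rewrite eq_sym next_neq ?mem_next // ltnW.
  have -> : G (prev d i) i i (next d i) = G x y y z.
    by apply: tr2; rewrite //= !inE negb_or andbT pi pn eq_sym ni.
  by ring.
rewrite (key c) // (key t) ?st //; ring.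
Qed.

(** The properties of crossings that the counting uses.  O x y z w stands for the
    number of crossings of the edges xy and zw, counted with sign, at which zw is the
    upper one.  Exchanging the two edges changes it by their planar intersection
    number, which is expressed by numbers U that involve one edge and one vertex, and
    by the order o of the vertices (0 for before, -1 for after). *)
Record crossing_data (V : eqType) (O : V -> V -> V -> V -> int)
    (U : V -> V -> V -> int) (o : V -> V -> int) : Prop := CrossingData {
  crossing_flipl : forall x y z w, O x y z w = - O y x z w;
  crossing_flipr : forall x y z w, O x y z w = - O x y w z;
  crossing_exchange : forall x y z w, uniq [:: x; y; z; w] -> O z w x y = O x y z w
    - (U x y z - U x y w + U z w y - U z w x - (o y z - o x z - o y w + o x w));
  crossing_order : forall x y, x != y -> o y x = - 1 - o x y }.

Lemma uniq_next4 (T : eqType) (c c' : seq T) (x z : T) :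
  uniq (c ++ c') -> (1 < size c)%N -> (1 < size c')%N -> x \in c -> z \in c' ->
  uniq [:: x; next c x; z; next c' z].
Proof.
rewrite cat_uniq => /and3P[uc /hasPn dis uc'] sc sc' xc zc'.
have nx := next_neq uc sc xc; have nz := next_neq uc' sc' zc'.
have ncc' a b : a \in c -> b \in c' -> a != b.
  by move=> ac bc'; apply: contra (dis b bc') => /eqP <-.
rewrite /= !inE !negb_or (eq_sym x) nx (eq_sym z) nz.
by rewrite !ncc' ?mem_next.
Qed.

(** Along two closed cycles the differences of O under exchange telescope: the planar
    intersection number of two closed curves is zero. *)
Lemma cycle_sum_sym (V : eqType) O U o (c c' : seq V) :
  crossing_data O U o -> uniq (c ++ c') -> (1 < size c)%N -> (1 < size c')%N ->
  cycle_sum O c' c = cycle_sum O c c'.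
Proof.
move=> cd ucc' sc sc'; have := ucc'; rewrite cat_uniq => /and3P[uc _ uc'].
rewrite /cycle_sum exchange_big /=; apply/eqP; rewrite -subr_eq0; apply/eqP.
rewrite -sumrB.
pose n := next c; pose n' := next c'.
have sumC (h : V -> V -> int) : \sum_(x <- c) \sum_(z <- c') (h x (n' z) - h x z) =
  0.
  by rewrite big1 // => x _; rewrite sumrB (sum_next (h x)) // subrr.
have sumC' (h : V -> V -> int) : \sum_(x <- c) \sum_(z <- c') (h (n x) z - h x z) =
  0.
  rewrite exchange_big big1 //= => z _.
  by rewrite sumrB (sum_next (h ^~ z)) // subrr.
transitivity (\sum_(x <- c) \sum_(z <- c') (U x (n x) (n' z) - U x (n x) z)
  - \sum_(x <- c) \sum_(z <- c') (U z (n' z) (n x) - U z (n' z) x)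
  - (\sum_(x <- c) \sum_(z <- c') (o (n x) (n' z) - o x (n' z))
     - \sum_(x <- c) \sum_(z <- c') (o (n x) z - o x z))).
  rewrite -!sumrB; apply: eq_big_seq => x xc; rewrite -!sumrB;
    apply: eq_big_seq => z zc'.
  by rewrite (crossing_exchange cd) ?uniq_next4 //; ring.
rewrite (sumC (fun x => U x (n x))) (sumC' (fun x z => U z (n' z) x)).
by rewrite (sumC' (fun x z => o x (n' z))) (sumC' o) !subr0.
Qed.

Definition perm_sum (T : finType) (O : T -> T -> T -> T -> int) (c c' : seq T) :
  int :=
  \sum_(s : {perm T}) cycle_sum O (map s c) (map s c') ^+ 2.

Lemma perm_sum_sym (T : finType) O U o (c c' : seq T) :
  crossing_data O U o -> uniq (c ++ c') -> (1 < size c)%N -> (1 < size c')%N ->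
  perm_sum O c' c = perm_sum O c c'.
Proof.
move=> cd ucc' sc sc'; apply: eq_bigr => s _; congr (_ ^+ 2).
by apply: cycle_sum_sym cd _ _ _; rewrite ?size_map // -map_cat map_inj_uniq //;
  apply: perm_inj.
Qed.

Lemma perm_sum_perm (T : finType) O (t : {perm T}) (c c' : seq T) :
  perm_sum O (map t c) (map t c') = perm_sum O c c'.
Proof.
rewrite [RHS](reindex_inj (mulgI t)); apply: eq_bigr => s _.
by rewrite -!map_comp; congr (cycle_sum _ _ _ ^+ 2); apply: eq_map => x;
  rewrite /= permM.
Qed.

(** The blocks c and c' are treated one after the other; the permutations of the
    complement of c' leave the part of c' unchanged. *)
Lemma perm_sum_triangle (T : finType) O (c c' t : seq T) :
  (forall x y z w, O x y z w = - O y x z w) ->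
  uniq (c ++ c') -> uniq (t ++ c') -> (2 < size c)%N -> size t = 3 ->
  3 * perm_sum O c c' = (size c)%:R * perm_sum O t c'.
Proof.
move=> fl; rewrite !cat_uniq => /and3P[uc dc uc'] /and3P[ut dt _] sc st.
pose phi (s : {perm T}) a b := \sum_(z <- c') O (s a) (s b) (s z) (s (next c' z)).
have E d : uniq d -> perm_sum O d c' =
  \sum_(s : {perm T}) (\sum_(x <- d) phi s x (next d x)) ^+ 2.
  move=> ud; apply: eq_bigr => s _; rewrite (@cycle_sum_map _ O s) //;
    exact: perm_inj.
rewrite !E //; apply: (@sum_sqr_cycle _ [pred x | x \notin c']) => //.
- by move=> s a b; rewrite /phi -sumrN; apply: eq_bigr => z _; rewrite fl.
- move=> u w s a b /= uc'N wc'N; apply: eq_big_seq => z zc'; rewrite !permM.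
  have K i : i \in c' -> tperm u w i = i.
    move=> ic'; apply: tpermD; by apply: contraTneq ic' => <-.
  by rewrite (K z) // (K (next c' z)) // mem_next.
- by rewrite has_sym -all_predC in dc; apply: sub_all dc.
- by rewrite has_sym -all_predC in dt; apply: sub_all dt.
Qed.

Definition splits (V : Type) (a b c d e g : V) : seq (seq V * seq V) :=
  [:: ([:: a; b; c], [:: d; e; g]);
      ([:: a; e; g], [:: d; b; c]); ([:: d; a; g], [:: e; b; c]);
      ([:: d; e; a], [:: g; b; c]); ([:: a; d; c], [:: b; e; g]);
      ([:: a; e; c], [:: d; b; g]); ([:: a; g; c], [:: d; e; b]);
      ([:: a; b; d], [:: c; e; g]); ([:: a; b; e], [:: d; c; g]);
      ([:: a; b; g], [:: d; e; c])].

Lemma splits_uniq (V : eqType) (a b c d e g : V) p :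
  uniq [:: a; b; c; d; e; g] -> p \in splits a b c d e g ->
  [/\ uniq (p.1 ++ p.2), size p.1 = 3 & size p.2 = 3].
Proof.
rewrite /= !inE !negb_or !andbT.
move=> /and5P[/and5P[ab ac ad ae ag] /and4P[bc bd be bg] /and3P[cd ce cg]
  /andP[de dg] eg].
have ne (x y : V) : x != y -> y != x by rewrite eq_sym.
have {ne} := (ne _ _ ab, ne _ _ ac, ne _ _ ad, ne _ _ ae, ne _ _ ag, ne _ _ bc,
  ne _ _ bd,
  ne _ _ be, ne _ _ bg, ne _ _ cd, ne _ _ ce, ne _ _ cg,
    (ne _ _ de, ne _ _ dg, ne _ _ eg)).
move=> [[[[[[[[[[[[ba ca] da] ea] ga] cb] db] eb] gb] dc] ec] gc] [[ed gd] ge]].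
by do ![case/orP] => /eqP -> /=; split=> //; rewrite !inE !negb_or;
  do ![apply/andP; split].
Qed.

Lemma sum_splits_neq0 (V : eqType) O U o (a b c d e g : V) :
  crossing_data O U o -> uniq [:: a; b; c; d; e; g] ->
  \sum_(p <- splits a b c d e g) cycle_sum O p.1 p.2 != 0.
Proof.
move=> cd uq; have [f1 f2 sw os] := cd.
pose tri (p : seq V * seq V) :=
  if p is ([:: p; q; r], [:: s; t; u]) then triangles O p q r s t u else 0.
rewrite (@eq_big_seq _ _ _ _ _ _ tri) => [|[p q] /(splits_uniq uq)[]]; last first.
  rewrite /= cat_uniq; case: p => [|? [|? [|? []]]] //;
    case: q => [|? [|? [|? []]]] //.
  by case/and3P=> up _ uq' _ _; exact: cycle_sum_triangles.
rewrite !big_cons big_nil /= addr0; apply/eqP;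
  have := sum_triangles_neq0 f1 f2 sw os uq.
by do !move: (triangles _ _ _ _ _ _ _) => ?; rewrite !addrA.
Qed.

Lemma sum_sqr_ge1 (I : eqType) (r : seq I) (F : I -> int) :
  \sum_(i <- r) F i != 0 -> 1 <= \sum_(i <- r) F i ^+ 2.
Proof.
move=> s0; case: (boolP (has (fun i => F i != 0) r)) => [/hasP[i ir Fi]|/hasPn h].
  rewrite (big_rem i) //= -[1]addr0 lerD //.
    by rewrite -gtz0_ge1 lt_def sqrf_eq0 Fi sqr_ge0.
  by apply: sumr_ge0 => j _; rewrite sqr_ge0.
by case/eqP: s0; rewrite big_seq big1 // => i /h; rewrite negbK => /eqP.
Qed.

(** All ten splits of six vertices have the same average of squares. *)
Lemma perm_sum_triangles_ge (T : finType) O U o (l l' : seq T) :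
  crossing_data O U o -> uniq (l ++ l') -> size l = 3 -> size l' = 3 ->
  ((#|T|)`!)%:R <= 10 * perm_sum O l l'.
Proof.
move=> cd ull sl sl'.
have [a [b [c [lE]]]] : exists a b c, l = [:: a; b; c].
  by case: l sl {ull} => [|a [|b [|c []]]] // _; exists a, b, c.
have [d [e [g l'E]]] : exists a b c, l' = [:: a; b; c].
  by case: l' sl' {ull} => [|d [|e [|g []]]] // _; exists d, e, g.
have uq : uniq [:: a; b; c; d; e; g] by rewrite lE l'E in ull.
have splitE p : p \in splits a b c d e g -> perm_sum O p.1 p.2 = perm_sum O l l'.
  case/(splits_uniq uq) => up sp sp'.
  pose H (k : seq T) := perm_sum O (take 3 k) (drop 3 k).
  have -> : perm_sum O p.1 p.2 = H (p.1 ++ p.2) by rewrite /H take_size_cat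
    ?drop_size_cat.
  have -> : perm_sum O l l' = H (l ++ l') by rewrite /H take_size_cat
    ?drop_size_cat.
  apply: (@tperm_transitive _ _ xpredT);
    rewrite ?all_predT ?size_cat ?sp ?sp' ?sl ?sl' //.
  by move=> u w _ _ k; rewrite /H -map_take -map_drop perm_sum_perm.
have -> : 10 * perm_sum O l l' = \sum_(p <- splits a b c d e g) perm_sum O p.1 p.2.
  by rewrite (eq_big_seq _ splitE) !big_cons big_nil; ring.
rewrite exchange_big /=.
have -> : ((#|T|)`!)%:R = \sum_(s : {perm T}) (1 : int).
  rewrite sumr_const -[#|T|]cardsT -card_perm; congr (_ *+ _).
  apply: eq_card => s; have -> // : s \in perm_on [set: T].
  by apply/subsetP => x _; rewrite inE.
apply: ler_sum => s _.
have uqs : uniq [:: s a; s b; s c; s d; s e; s g].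
  by rewrite -[[:: s a; _; _; _; _; _]]/(map s [:: a; b; c; d; e; g])
    map_inj_uniq //; exact: perm_inj.
rewrite (eq_bigr (fun p => cycle_sum O (map s p.1) (map s p.2) ^+ 2)) //.
apply: sum_sqr_ge1.
have := sum_splits_neq0 cd uqs.
by rewrite -[splits (s a) _ _ _ _ _]/(map (fun p => (map s p.1, map s p.2))
  (splits a b c d e g)) big_map.
Qed.

Lemma perm_sum_ge (T : finType) O U o (c c' : seq T) :
  crossing_data O U o -> uniq (c ++ c') -> (2 < size c)%N -> (2 < size c')%N ->
  (size c * size c' * (#|T|)`!)%:R <= 90 * perm_sum O c c'.
Proof.
move=> cd ucc sc sc'.
pose t := take 3 c; pose t' := take 3 c'.
have st : size t = 3 by rewrite size_takel.
have st' : size t' = 3 by rewrite size_takel.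
have fl := crossing_flipl cd.
have sub (a b : seq T) : subseq a c -> subseq b c' -> uniq (a ++ b).
  by move=> ac bc; apply: subseq_uniq ucc; exact: cat_subseq.
have uc : uniq (t ++ c') by rewrite sub ?take_subseq.
have ut : uniq (t ++ t') by rewrite sub ?take_subseq.
have e1 := perm_sum_triangle fl ucc uc sc st.
have e2 : 3 * perm_sum O t c' = (size c')%:R * perm_sum O t t'.
  rewrite -(perm_sum_sym cd uc) ?st // ?(ltn_trans _ sc') //.
  rewrite -(perm_sum_sym cd ut) ?st ?st' //.
  by apply: perm_sum_triangle; rewrite // uniq_catC.
have e3 := perm_sum_triangles_ge cd ut st st'.
have -> : 90 * perm_sum O c c' = (size c * size c')%:R * (10 * perm_sum O t t').
  have : 3 * (3 * perm_sum O c c') = (size c)%:R * ((size c')%:R * perm_sum O t t').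
    by rewrite e1 -e2; ring.
  rewrite natrM => h; rewrite mulrCA -mulrA -h; ring.
by rewrite natrM ler_wpM2l.
Qed.

(** * Linking numbers as sums over pairs of edges *)

Definition edge_linking (R : realType) (n : nat) (f : spatial_embedding R n)
  (v : 'rV[R]_3) :=
  sum_arcs f (over_crossing v).

Lemma over_crossing_exchange (R : realType) (v : 'rV[R]_3) s s' :
  apart s s' -> over_crossing v s' s =
    over_crossing v s s' - planar_crossing v s s'.
Proof.
move=> ap; have ap' : apart s' s by move=> t t' tI t'I /esym; exact: ap.
have := over_crossing_double v ap; have := over_crossing_double v ap'.
by rewrite signed_crossing_sym planar_crossing_sym !mulr2n; lia.
Qed.

Lemma edge_linking_exchange (R : realType) (n : nat) (f : spatial_embedding R n) v
  (x y z w : 'I_n) :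
  uniq [:: x; y; z; w] ->
  edge_linking f v z w x y =
  edge_linking f v x y z w - sum_arcs f (planar_crossing v) x y z w.
Proof.
move=> uq; rewrite /edge_linking /sum_arcs uniq4_sym uq exchange_big -sumrB.
apply: eq_big_seq => s sin; rewrite -sumrB; apply: eq_big_seq => s' s'in.
exact/over_crossing_exchange/(arc_segments_apart uq sin s'in).
Qed.

Lemma edge_linking_signed (R : realType) (n : nat) (f : spatial_embedding R n) v
  (x y z w : 'I_n) :
  uniq [:: x; y; z; w] ->
  \sum_(s <- arc_segments f x y) \sum_(s' <- arc_segments f z w) signed_crossing v s
    s' =
  edge_linking f v x y z w + edge_linking f v z w x y.
Proof.
move=> uq; rewrite (edge_linking_exchange f v uq) addrA /edge_linking /sum_arcs uq
  -big_split -sumrB.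
apply: eq_big_seq => s sin; rewrite -big_split -sumrB;
  apply: eq_big_seq => s' s'in /=.
have := over_crossing_double v (arc_segments_apart uq sin s'in);
  rewrite mulr2n => <-.
by rewrite addrK.
Qed.

Lemma edge_linking_data (R : realType) (n : nat) (f : spatial_embedding R n) v u :
  good_directions f v u ->
  crossing_data (edge_linking f v) (arc_upper f v u) (precedes f v u).
Proof.
move=> good; have flipl x y z w : edge_linking f v y x z w =
  - edge_linking f v x y z w.
  by apply: sum_arcs_flip => s s'; exact: over_crossing_flip.
split.
- by move=> x y z w; exact: flipl.
- move=> x y z w; rewrite /edge_linking.
  pose k s s' := over_crossing v s' s.
  rewrite (@sum_arcs_sym _ _ f (over_crossing v) k z w x y) //.
  rewrite (@sum_arcs_sym _ _ f (over_crossing v) k w z x y) //.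
  by apply: sum_arcs_flip => s s'; exact: over_crossing_flipr.
- by move=> x y z w uq; rewrite edge_linking_exchange //
    (planar_crossing_decomposition good uq).
- by move=> x y xy; rewrite (precedes_sym good xy).
Qed.

Lemma polygon_edges_polyline (R : realType) (P : seq 'rV[R]_3) :
  polyline (polygon_edges P) (head 0 P) (head 0 P).
Proof. by move=> h; rewrite polygon_edgesE sum_chain; case: P. Qed.

(** Over two cycles the crossings with one curve on top and those with the other on
    top have the same sum, so half of the sum of both is either of them. *)
Lemma linking_number_cycle_sum (R : realType) (n : nat) (f : spatial_embedding R n)
  v u
    (c c' : seq 'I_n) :
  good_directions f v u -> uniq (c ++ c') -> (1 < size c)%N -> (1 < size c')%N ->
  linking_number (cycle_polygon f c) (cycle_polygon f c') =
  (cycle_sum (edge_linking f v) c c')%:~R.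
Proof.
move=> good ucc sc sc'; have [v0 reg _] := good.
have := ucc; rewrite cat_uniq => /and3P[uc _ uc'].
have mem s s' : s \in polygon_edges (cycle_polygon f c) ->
    s' \in polygon_edges (cycle_polygon f c') ->
    exists x z, [/\ uniq [:: x; next c x; z; next c' z],
      s \in arc_segments f x (next c x) & s' \in arc_segments f z (next c' z)].
  rewrite !cycle_polygon_edges // => /flatten_mapP[x xc sx] /flatten_mapP[z zc s'z].
  by exists x, z; split=> //; exact: uniq_next4.
rewrite (@linking_numberE _ _ _ _ _ v (@polygon_edges_polyline _ _)
  (@polygon_edges_polyline _ _)) //.
- rewrite !cycle_polygon_edges // big_flatten big_map.
  have -> : \sum_(x <- c) \sum_(s <- arc_segments f x (next c x))
      \sum_(s' <- flatten [seq arc_segments f z (next c' z) | z <- c'])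
        signed_crossing v s s' =
      cycle_sum (edge_linking f v) c c' + cycle_sum (edge_linking f v) c' c.
    rewrite /cycle_sum [X in _ = _ + X]exchange_big -big_split;
      apply: eq_big_seq => x xc.
    rewrite -big_split /=.
    under eq_bigr do rewrite big_flatten big_map.
    rewrite exchange_big; apply: eq_big_seq => z zc' /=.
    by rewrite edge_linking_signed // uniq_next4.
  rewrite (cycle_sum_sym (edge_linking_data good) ucc sc sc') intrD.
  by field.
- by move=> s s' /mem h /h [x [z [uq sin s'in]]];
    exact: arc_segments_apart uq sin s'in.
- by move=> s s' /mem h /h [x [z [uq sin s'in]]];
    have [] := reg _ _ _ _ _ _ uq sin s'in.
Qed.

(** * Orientations of a cycle *)

Lemma next_ind (T : eqType) (c : seq T) (P : T -> Prop) (x : T) :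
  uniq c -> x \in c -> P x -> (forall y, y \in c -> P y -> P (next c y)) ->
  forall y, y \in c -> P y.
Proof.
move=> uc xc Px step.
have c0 : (0 < size c)%N by case: c xc {uc step}.
have H k : P (nth x c ((index x c + k) %% size c)).
  elim: k => [|k IH]; first by rewrite addn0 modn_small ?index_mem // nth_index.
  have kc := ltn_pmod (index x c + k) c0.
  have := step _ (mem_nth x kc) IH; rewrite next_mod // -addn1 modnDml addn1
    -addnS //.
move=> y yc; have ic : (index x c < size c)%N by rewrite index_mem.
have := H (size c - index x c + index y c)%N.
by rewrite addnA subnKC ?(ltnW ic) // modnDl modn_small ?index_mem // nth_index.
Qed.

Lemma mem_cycle_edges (n : nat) (c : seq 'I_n) (x y : 'I_n) :
  uniq c -> (1 < size c)%N -> x \in c ->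
  ([set x; y] \in cycle_edges c) = (y == next c x) || (y == prev c x).
Proof.
move=> uc sc xc; apply/imsetP/orP => [[z zc E]|[/eqP->|/eqP->]].
- have nz := next_neq uc sc zc.
  have : x \in [set z; next c z] by rewrite -E !inE eqxx.
  rewrite !inE => /orP[/eqP xz|/eqP xnz].
    left; have : next c z \in [set x; y] by rewrite E !inE eqxx orbT.
    by rewrite !inE xz (negbTE nz) eq_sym.
  right; have : z \in [set x; y] by rewrite E !inE eqxx.
  by rewrite xnz prev_next // !inE eq_sym (negbTE nz) eq_sym.
- by exists x.
- by exists (prev c x); rewrite ?mem_prev // next_prev // setUC.
Qed.

Lemma cover_cycle_edges (n : nat) (c : seq 'I_n) (x : 'I_n) :
  (x \in cover (cycle_edges c)) = (x \in c).
Proof.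
apply/bigcupP/idP => [[e /imsetP[y yc ->]]|xc].
  by rewrite !inE => /orP[/eqP->|/eqP->]; rewrite ?mem_next.
by exists [set x; next c x]; rewrite ?inE ?eqxx //; apply/imsetP; exists x.
Qed.

Lemma card_cycle_edges (n : nat) (c : seq 'I_n) :
  uniq c -> (2 < size c)%N -> #|cycle_edges c| = size c.
Proof.
move=> uc sc; rewrite card_in_imset ?(card_uniqP uc) // => x y xc yc E.
have sc1 := ltnW sc.
have : x \in [set y; next c y] by rewrite -E !inE eqxx.
rewrite !inE => /orP[/eqP //|/eqP xny].
have : y \in [set x; next c x] by rewrite E !inE eqxx.
rewrite !inE => /orP[/eqP //|/eqP ynx].
by have := next2_neq uc sc xc; rewrite -ynx -xny eqxx.
Qed.

(** If the orientations agree at one vertex y, then they agree at its successor: the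
    neighbour other than y is the same for both. *)
Lemma next_agree (T : eqType) (c d : seq T) (x : T) :
  uniq c -> uniq d -> (2 < size d)%N -> c =i d -> x \in c ->
  (forall y, y \in c -> next d y = next c y \/ next d y = prev c y) ->
  next d x = next c x -> forall y, y \in c -> next d y = next c y.
Proof.
move=> uc ud sd cd xc nbr nx.
apply: (next_ind uc xc nx) => y yc ny.
have nyc : next c y \in c by rewrite mem_next.
have [//|] := nbr _ nyc.
by rewrite prev_next // -ny => e; have := next2_neq ud sd (etrans (esym (cd y)) yc);
  rewrite e eqxx.
Qed.

(** The set of edges determines the two neighbours of each vertex, so a cycle has two
    orientations, distinguished by the successor of any one vertex. *)
Lemma same_cycle_edges (n : nat) (c d : seq 'I_n) (x : 'I_n) :
  uniq c -> uniq d -> (2 < size c)%N -> (2 < size d)%N -> cycle_edges d =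
    cycle_edges c ->
  x \in c ->
  (next d x == next c x -> forall y, y \in c -> next d y = next c y) /\
  (next d x != next c x -> forall y, y \in c -> next d y = prev c y).
Proof.
move=> uc ud sc sd E xc.
have cd : c =i d by move=> y; rewrite -!cover_cycle_edges E.
have nbr y : y \in c -> next d y = next c y \/ next d y = prev c y.
  move=> yc; have : [set y; next d y] \in cycle_edges d.
    by apply/imsetP; exists y; rewrite -?cd.
  by rewrite E mem_cycle_edges // ?(ltnW sc) // => /orP[]/eqP; [left|right].
split=> [/eqP|] nx; first exact: (next_agree uc ud sd cd xc nbr nx).
move=> y yc; have [e|nx'] := nbr x xc; first by rewrite e eqxx in nx.
rewrite -(next_rev uc); apply: (@next_agree _ (rev c) d x) => //.
- by rewrite rev_uniq.
- by move=> z; rewrite mem_rev cd.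
- by rewrite mem_rev.
- by move=> z; rewrite mem_rev next_rev // prev_rev // => /nbr[]; [right|left].
- by rewrite next_rev.
- by rewrite mem_rev.
Qed.

Lemma eq_from_next (T : eqType) (c d : seq T) (x0 : T) :
  uniq c -> uniq d -> size c = size d -> nth x0 c 0 = nth x0 d 0 ->
  (forall x, x \in c -> next c x = next d x) -> c = d.
Proof.
move=> uc ud sz h N; apply: (@eq_from_nth _ x0) => // i ic.
elim: i ic => [//|i IH] ic; have ic' := ltnW ic.
have := N _ (mem_nth x0 ic'); rewrite next_mod // modn_small // => ->.
by rewrite IH // next_mod -?sz // modn_small.
Qed.

Definition cycle_orientations (n p : nat) (E : {set {set 'I_n}}) :
  {set p.-tuple 'I_n} :=
  [set c : p.-tuple 'I_n | uniq c && (cycle_edges c == E)].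

(** A cyclic sequence with given edges is determined by its first vertex and by one
    of two orientations. *)
Lemma card_cycle_orientations (n p : nat) (E : {set {set 'I_n}}) :
  (2 < p)%N -> (#|cycle_orientations p E| <= 2 * p)%N.
Proof.
case: p => // p p2; case: (set_0Vmem (cycle_orientations p.+1 E)) => [->|[c0]].
  by rewrite cards0.
rewrite inE => /andP[u0 /eqP E0].
pose g (c : p.+1.-tuple 'I_n) : bool * 'I_p.+1 :=
  (next c (thead c) == next c0 (thead c), inord (index (thead c) c0)).
rewrite -(@card_in_imset _ _ g).
  by apply: leq_trans (max_card _) _; rewrite card_prod card_bool card_ord.
move=> c d; rewrite !inE => /andP[uc /eqP Ec] /andP[ud /eqP Ed] [eb ei].
have mem (b : p.+1.-tuple 'I_n) : cycle_edges b = E -> thead b \in c0.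
  by move=> Eb; rewrite -cover_cycle_edges E0 -Eb cover_cycle_edges /thead
    (tnth_nth (thead b)) mem_nth // size_tuple.
have eh : thead c = thead d.
  have ic (b : p.+1.-tuple 'I_n) : cycle_edges b = E ->
    (index (thead b) c0 < p.+1)%N.
    by move=> /mem; rewrite -index_mem size_tuple.
  have /(congr1 val) := ei; rewrite /= !inordK ?ic //.
  by move/(congr1 (nth (thead c) c0)); rewrite !nth_index ?mem.
have sz (b : p.+1.-tuple 'I_n) : (2 < size b)%N by rewrite size_tuple.
have cc0 y : y \in tval c -> y \in tval c0 by rewrite -!cover_cycle_edges Ec E0.
have [c1 c2] := same_cycle_edges u0 uc (sz c0) (sz c) (etrans Ec (esym E0))
  (mem c Ec).
have [d1 d2] := same_cycle_edges u0 ud (sz c0) (sz d) (etrans Ed (esym E0))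
  (mem d Ed).
apply: val_inj; apply: (@eq_from_next _ _ _ (thead c)) => //;
  first by rewrite !size_tuple.
  have th (b : p.+1.-tuple 'I_n) : nth (thead c) b 0 = thead b.
    by rewrite [RHS](tnth_nth (thead c)).
  by rewrite !th.
move=> x /cc0 xc0; case: (boolP (next c (thead c) == next c0 (thead c))) => b.
  by rewrite c1 // d1 // -eb.
by rewrite c2 // d2 // -eb.
Qed.

Lemma cycle_sum_reorient (n : nat) (O : 'I_n -> 'I_n -> 'I_n -> 'I_n -> int)
  (c d e : seq 'I_n) :
  (forall x y z w, O x y z w = - O y x z w) ->
  uniq c -> uniq d -> (2 < size c)%N -> (2 < size d)%N -> cycle_edges d =
    cycle_edges c ->
  cycle_sum O d e ^+ 2 = cycle_sum O c e ^+ 2.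
Proof.
move=> fl uc ud sc sd E.
pose phi x y := \sum_(z <- e) O x y z (next e z).
rewrite /cycle_sum -!/(\sum_(x <- _) phi x (next _ x)).
have pcd : perm_eq d c.
  by apply: uniq_perm => // y; rewrite -!cover_cycle_edges E.
have [x xc] : exists x, x \in c by case: c sc {uc E pcd} => // x c _; exists x;
  rewrite mem_head.
have [h1 h2] := same_cycle_edges uc ud sc sd E xc.
rewrite (perm_big _ pcd) /=; case: (boolP (next d x == next c x)) => [/h1|/h2] N.
  by congr (_ ^+ 2); apply: eq_big_seq => y /N ->.
rewrite -sqrrN; congr (_ ^+ 2).
rewrite -(sum_next (fun y => \sum_(z <- e) O y (next d y) z (next e z)) uc) -sumrN.
apply: eq_big_seq => y yc; rewrite -sumrN; apply: eq_bigr => z _.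
by rewrite -fl N ?mem_next // prev_next.
Qed.

(** * The inequalities *)

Lemma orient_cycle_edges (n : nat) (c : seq 'I_n) : uniq c -> (2 < size c)%N ->
  [/\ uniq (orient (cycle_edges c)), cycle_edges (orient (cycle_edges c)) =
    cycle_edges c
    & size (orient (cycle_edges c)) = size c].
Proof.
move=> uc sc; rewrite /orient; case: pickP => [d /andP[ud /eqP dE]|none].
  by split=> //; rewrite size_tuple card_cycle_edges.
have sE : size c == #|cycle_edges c| by rewrite card_cycle_edges.
by have := none (Tuple sE); rewrite /= uc eqxx.
Qed.

(** The order and the orientation of the components are chosen arbitrarily in lk, but
    they only affect the sign of the linking number. *)
Lemma lk_cycles_sqr (R : realType) (n : nat) (f : spatial_embedding R n) v u
  (c c' : seq 'I_n) :
  good_directions f v u -> uniq (c ++ c') -> (2 < size c)%N -> (2 < size c')%N ->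
  lk f [set cycle_edges c; cycle_edges c'] ^+ 2 =
  (cycle_sum (edge_linking f v) c c' ^+ 2)%:~R.
Proof.
move=> good; have data := edge_linking_data good; have fl := crossing_flipl data.
have key (d e : seq 'I_n) : uniq (d ++ e) -> (2 < size d)%N -> (2 < size e)%N ->
    linking_number (cycle_polygon f (orient (cycle_edges d)))
      (cycle_polygon f (orient (cycle_edges e))) ^+ 2 =
    (cycle_sum (edge_linking f v) d e ^+ 2)%:~R.
  move=> ude sd se; have := ude; rewrite cat_uniq => /and3P[ud /hasPn de ue].
  have [ud' Ed sd'] := orient_cycle_edges ud sd.
  have [ue' Ee se'] := orient_cycle_edges ue se.
  set d' := orient _ in ud' Ed sd' *; set e' := orient _ in ue' Ee se' *.
  have memd x : (x \in d') = (x \in d) by rewrite -!cover_cycle_edges Ed.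
  have meme x : (x \in e') = (x \in e) by rewrite -!cover_cycle_edges Ee.
  have ude' : uniq (d' ++ e').
    by rewrite cat_uniq ud' ue' andbT; apply/hasPn => x; rewrite meme memd => /de.
  have ude2 : uniq (d ++ e').
    by rewrite cat_uniq ud ue' andbT; apply/hasPn => x; rewrite meme => /de.
  rewrite (linking_number_cycle_sum good ude') ?sd' ?se' ?(ltn_trans _ sd)
    ?(ltn_trans _ se) //.
  rewrite -rmorphXn /=; congr (_%:~R).
  rewrite (cycle_sum_reorient _ fl ud ud') ?sd' //.
  rewrite -(cycle_sum_sym data ude2) ?se' ?(ltn_trans _ sd) ?(ltn_trans _ se) //.
  rewrite (cycle_sum_reorient _ fl ue ue') ?se' //.
  by rewrite (cycle_sum_sym data ude) ?(ltn_trans _ sd) ?(ltn_trans _ se).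
move=> ucc sc sc'; have := ucc; rewrite cat_uniq => /and3P[uc /hasPn dis uc'].
have EE' : cycle_edges c != cycle_edges c'.
  have [x xc'] : exists x, x \in c' by case: c' sc' {ucc dis uc'} => // x e _;
    exists x; rewrite mem_head.
  by apply: contra (dis x xc') => /eqP E;
    rewrite -cover_cycle_edges E cover_cycle_edges.
have : perm_eq (enum [set cycle_edges c; cycle_edges c'])
  [:: cycle_edges c; cycle_edges c'].
  apply: uniq_perm; rewrite ?enum_uniq //= ?inE ?EE' //.
  by move=> E; rewrite mem_enum !inE.
rewrite /lk => enumE.
have sz := perm_size enumE.
case: (enum _) sz enumE => [|A [|B []]] // _ enumE.
have : A \in [:: cycle_edges c; cycle_edges c'] by rewrite -(perm_mem enumE)
  mem_head.
rewrite !inE => /orP[/eqP AE|/eqP AE]; move: enumE; rewrite AE.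
  by rewrite perm_cons => /(@perm_small_eq _ _ [:: _] isT) [->] /=; rewrite key.
rewrite perm_sym -[[:: cycle_edges c; _]]/([:: cycle_edges c] ++
  [:: cycle_edges c']) perm_catC /=.
rewrite perm_cons perm_sym => /(@perm_small_eq _ _ [:: _] isT) [->] /=.
rewrite key ?(uniq_catC c') //; congr ((_ ^+ 2)%:~R).
by rewrite (cycle_sum_sym data) // ltnW.
Qed.

Definition low_block (p q : nat) : p.-tuple 'I_(p + q) := map_tuple (lshift q)
  (ord_tuple p).
Definition high_block (p q : nat) : q.-tuple 'I_(p + q) := map_tuple (@rshift p q)
  (ord_tuple q).

Lemma uniq_blocks (p q : nat) : uniq (low_block p q ++ high_block p q).
Proof.
rewrite cat_uniq (map_inj_uniq (@lshift_inj p q)) (map_inj_uniq (@rshift_inj p q))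
  !enum_uniq.
rewrite andbT /=; apply/hasPn => x /mapP[j _ ->]; apply/negP => /mapP[i _ /eqP].
by rewrite eq_sym eq_lrshift.
Qed.

Definition block_cycles (p q : nat) (s : {perm 'I_(p + q)}) :
    {set {set 'I_(p + q)}} * {set {set 'I_(p + q)}} :=
  (cycle_edges (map s (low_block p q)), cycle_edges (map s (high_block p q))).

Lemma uniq_perm_blocks (p q : nat) (s : {perm 'I_(p + q)}) :
  uniq (map s (low_block p q) ++ map s (high_block p q)).
Proof. by rewrite -map_cat map_inj_uniq ?uniq_blocks //; exact: perm_inj. Qed.

Lemma card_block_cycles (p q : nat) (F : {set {set 'I_(p + q)}} *
  {set {set 'I_(p + q)}}) :
  (2 < p)%N -> (2 < q)%N ->
  (#|[set s | block_cycles s == F]| <= 4 * (p * q))%N.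
Proof.
move=> p3 q3.
pose g (s : {perm 'I_(p + q)}) := (map_tuple s (low_block p q),
  map_tuple s (high_block p q)).
have gI : injective g.
  move=> s s' [/eq_in_map e /eq_in_map e']; apply/permP => x.
  rewrite -(splitK x); case: (fintype.split x) => i /=; [apply: e | apply: e'].
    by rewrite map_f // mem_enum.
  by rewrite map_f // mem_enum.
rewrite -(card_imset _ gI).
apply: (@leq_trans #|setX (cycle_orientations p F.1) (cycle_orientations q F.2)|).
  apply/subset_leq_card/subsetP => y /imsetP[s]; rewrite inE => /eqP sF ->.
  have := uniq_perm_blocks s; rewrite cat_uniq => /and3P[us _ us'].
  by rewrite !inE /= us us' -sF /= !eqxx.
rewrite cardsX (_ : 4 * (p * q) = (2 * p) * (2 * q))%N; last by lia.
by rewrite leq_mul // card_cycle_orientations.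
Qed.

(** The number of orientations and starting points is 2p for one cycle and 2q for the
    other.  If p = q the two blocks may be mapped to the two cycles in either order. *)
Lemma card_block_cycle_pairs (p q : nat) (L : {set {set {set 'I_(p + q)}}}) :
  (2 < p)%N -> (2 < q)%N ->
  (#|[set s : {perm 'I_(p + q)} | [set (block_cycles s).1; (block_cycles s).2] ==
    L]|
    <= (if p == q then 8 else 4) * (p * q))%N.
Proof.
move=> p3 q3; set A := [set s | _].
have [->|[s0]] := set_0Vmem A; first by rewrite cards0.
rewrite inE => /eqP s0L.
pose B F := [set s | @block_cycles p q s == F].
have card1 s : #|(@block_cycles p q s).1| = p /\ #|(block_cycles s).2| = q.
  have := uniq_perm_blocks s; rewrite cat_uniq => /and3P[us _ us'].
  by split; rewrite card_cycle_edges // size_map size_tuple.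
have sub s : s \in A -> block_cycles s = block_cycles s0 \/
    p = q /\ block_cycles s = ((block_cycles s0).2, (block_cycles s0).1).
  rewrite inE -s0L => /eqP E.
  have [cp cq] := card1 s; have [cp0 cq0] := card1 s0.
  move: E cp cq cp0 cq0; case: (block_cycles s) (block_cycles s0) =>
    [a b] [a0 b0] /= E cp cq cp0 cq0.
  have : a \in [set a0; b0] by rewrite -E !inE eqxx.
  have : b \in [set a0; b0] by rewrite -E !inE eqxx orbT.
  have : a0 \in [set a; b] by rewrite E !inE eqxx.
  have : b0 \in [set a; b] by rewrite E !inE eqxx orbT.
  rewrite !inE => /orP[]/eqP e1 /orP[]/eqP e2 /orP[]/eqP e3 /orP[]/eqP e4; subst;
    by [left | right; split=> //; lia].
case: (eqVneq p q) => [pq|pq].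
  apply: (@leq_trans #|B (block_cycles s0) :|: B
    ((block_cycles s0).2, (block_cycles s0).1)|).
    apply/subset_leq_card/subsetP => s /sub; rewrite !inE => -[->|[_ ->]];
      first by rewrite eqxx.
    by rewrite eqxx orbT.
  apply: leq_trans (leq_card_setU _ _) _.
  by rewrite (_ : 8 = 4 + 4)%N // mulnDl leq_add // card_block_cycles.
apply: (@leq_trans #|B (block_cycles s0)|); last exact: card_block_cycles.
apply/subset_leq_card/subsetP => s /sub; rewrite !inE => -[->|[e]]; first by [].
by rewrite e eqxx in pq.
Qed.

Lemma block_cycles_pairs (p q : nat) (s : {perm 'I_(p + q)}) :
  (2 < p)%N -> (2 < q)%N ->
  [set (block_cycles s).1; (block_cycles s).2] \in cycle_pairs (p + q) p q.
Proof.
move=> p3 q3; have := uniq_perm_blocks s;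
  rewrite cat_uniq => /and3P[us /hasPn dis us'].
apply/imset2P; exists (block_cycles s).1 (block_cycles s).2 => //.
  rewrite inE p3; apply/existsP; exists (map_tuple s (low_block p q)).
  by rewrite us eqxx.
rewrite !inE q3 /=; apply/andP; split.
  by apply/existsP; exists (map_tuple s (high_block p q)); rewrite us' eqxx.
rewrite disjoint_sym disjoint_subset; apply/subsetP => x.
by rewrite !inE !cover_cycle_edges => /dis.
Qed.

(** Compare the average of the squares over all permutations, bounded below by
    perm_sum_ge, with the number of permutations that give the same pair of cycles. *)
Lemma sum_lk_sqr_ge (R : realType) (p q : nat) (f : spatial_embedding R (p + q)) :
  (2 < p)%N -> (2 < q)%N ->
  \sum_(L in cycle_pairs (p + q) p q) lk f L ^+ 2 >=
    (if p == q then (p + q)`!%:R / 6`!%:R else 2 * ((p + q)`!%:R / 6`!%:R)).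
Proof.
move=> p3 q3; have [v [u good]] := good_directions_ex f.
have data := edge_linking_data good.
set S := \sum_(L in _) _.
have S0 : 0 <= S by apply: sumr_ge0 => L _; rewrite sqr_ge0.
pose m : nat := if p == q then 8 else 4.
pose PS := perm_sum (edge_linking f v) (low_block p q) (high_block p q).
have upper : PS%:~R <= (m * (p * q))%:R * S.
  have -> : PS%:~R = \sum_(s : {perm 'I_(p + q)}) lk f
    [set (block_cycles s).1; (block_cycles s).2] ^+ 2.
    rewrite /PS /perm_sum rmorph_sum /=; apply: eq_bigr => s _.
    apply/esym; apply: (lk_cycles_sqr good (uniq_perm_blocks s)).
      by rewrite size_map size_tuple.
    by rewrite size_map size_tuple.
  rewrite (partition_big (fun s => [set (block_cycles s).1; (block_cycles s).2])
    (mem (cycle_pairs (p + q) p q))) /=; last by move=> s _;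
      exact: block_cycles_pairs.
  rewrite mulr_sumr; apply: ler_sum => L _.
  rewrite (eq_bigr (fun=> lk f L ^+ 2)) => [|s /eqP -> //].
  rewrite sumr_const -[leLHS]mulr_natl ler_wpM2r ?sqr_ge0 // ler_nat.
  by rewrite -cardsE; exact: card_block_cycle_pairs.
have lower : ((p * q) * (p + q)`!)%:R <= 90 * PS%:~R :> rat.
  have := perm_sum_ge data (uniq_blocks p q);
    rewrite !size_tuple card_ord => /(_ p3 q3).
  by rewrite -(ler_int rat) intrM !mulrz_nat.
have bound : (p * q)%:R * (p + q)`!%:R <= (p * q)%:R * (90 * m%:R * S).
  move: upper lower; rewrite (natrM _ m) (natrM _ (p * q)%N).
  move: PS%:~R (p * q)%:R (p + q)`!%:R m%:R S {S0} => a b c d e; lra.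
move: bound; rewrite ler_pM2l; last by rewrite ltr0n muln_gt0 !(ltn_trans _ p3)
  ?(ltn_trans _ q3).
rewrite /m (_ : 6`! = 720)%N //; move: ((p + q)`!%:R) => c.
by case: eqP => _ h; lra.
Qed.

Lemma sum_lt_minn (m k : nat) : (\sum_(3 <= i < m) (i < k) = minn m k - 3)%N.
Proof.
elim: m => [|m IH]; first by rewrite big_geq // min0n.
have [h|h] := leqP 3 m; last by rewrite big_geq //; lia.
by rewrite big_nat_recr //= IH; case: ltnP; lia.
Qed.

(** The weight of an unordered pair is the number of its orderings, and the ordered
    pairs are (p, n - p) for 3 <= p <= n - 3. *)
Lemma sum_partitions (n : nat) : (6 <= n)%N ->
  (\sum_(3 <= p < n.+1) \sum_(p <= q < n.+1 | p + q == n)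
    (if p == q then 1 else 2) = n - 5)%N.
Proof.
move=> n6.
transitivity (\sum_(3 <= p < n.+1) ((p < n./2.+1) + (p < uphalf n)))%N; last first.
  rewrite big_split /= !sum_lt_minn; lia.
apply: eq_big_nat => p /andP[p3 pn].
have [h|h] := leqP p.*2 n; last first.
  rewrite big_nat_cond big1 => [|q /andP[/andP[pq _] /eqP e]]; last by lia.
  by case: ltnP; case: ltnP; lia.
rewrite big_mkcond (bigD1_seq (n - p)%N) ?iota_uniq //=;
  last by rewrite mem_index_iota; lia.
rewrite big1 => [|q qn]; last by case: eqP => // e; move/eqP: qn; lia.
rewrite subnKC ?eqxx; last by lia.
by case: (eqVneq p (n - p)%N); case: ltnP; case: ltnP; lia.
Qed.

Unset Implicit Arguments.

Theorem corollary1p7 (R : realType) (n : nat) (hn : (6 <= n)%N)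
    (f : spatial_embedding R n) :
  (forall p q : nat, (3 <= p)%N -> (3 <= q)%N -> n = (p + q)%N ->
     \sum_(L in cycle_pairs n p q) lk f L ^+ 2 >=
       (if p == q then n`!%:R / 6`!%:R else 2 * (n`!%:R / 6`!%:R))) /\
  \sum_(3 <= p < n.+1) \sum_(p <= q < n.+1 | (p + q)%N == n)
     \sum_(L in cycle_pairs n p q) lk f L ^+ 2 >=
    (n - 5)%:R * (n`!%:R / 6`!%:R).
Proof.
have part1 p q : (3 <= p)%N -> (3 <= q)%N -> n = (p + q)%N ->
    \sum_(L in cycle_pairs n p q) lk f L ^+ 2 >=
      (if p == q then n`!%:R / 6`!%:R else 2 * (n`!%:R / 6`!%:R)).
  by move=> p3 q3 E; move: f; rewrite E => f'; exact: sum_lk_sqr_ge.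
split=> //.
rewrite -(sum_partitions hn) natr_sum mulr_suml;
  apply: ler_sum_nat => p /andP[p3 _].
rewrite natr_sum mulr_suml big_nat_cond [leRHS]big_nat_cond.
apply: ler_sum => q /andP[/andP[pq _] /eqP E].
apply: le_trans (part1 p q p3 (leq_trans p3 pq) (esym E)).
by case: eqP => _; rewrite ?mul1r.
Qed.
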